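(* Let $m\ge1$ and $X_m=\tfrac{1}{\sqrt{2m}}(D_4)_{2m}\subset\mathbb{S}^3$. Then $6$ belongs to the harmonic strength of $X_m$ (i.e. $\sum_{x\in X_m}P(x)=0$ for all $P\in\mathrm{Harm}_6(\mathbb{R}^4)$) if and only if $\tau_2(m)=0$, where the integers $\tau_2(m)$ are defined by $\sum_{m\ge1}\tau_2(m)q^m=\eta(z)^8\eta(2z)^8$.
   Context: $D_4=\{x\in\mathbb{Z}^4: x_1+x_2+x_3+x_4\equiv0\bmod 2\}$, and for $n\ge0$, $(D_4)_n=\{x\in D_4: x_1^2+x_2^2+x_3^2+x_4^2=n\}$. $\mathrm{Harm}_\ell(\mathbb{R}^d)$ is the real space of homogeneous harmonic polynomials of degree exactly $\ell$ in $d$ variables. For $T\subset\mathbb{N}$, a finite nonempty $X\subset\mathbb{S}^{d-1}$ is a spherical $T$-design if $\sum_{x\in X}P(x)=0$ for all $P\in\mathrm{Harm}_\ell(\mathbb{R}^d)$, $\ell\in T$; the harmonic strength of $X$ is the maximal such $T$, i.e. the set of all $\ell\in\mathbb{N}$ with $\sum_{x\in X}P(x)=0$ for all $P\in\mathrm{Harm}_\ell(\mathbb{R}^d)$. $\eta(z)=q^{1/24}\prod_{n\ge1}(1-q^n)$ is the Dedekind eta function, $q=e^{2\pi i z}$; $\eta(z)^8\eta(2z)^8$ is the unique normalized cusp form of weight 8 and level 2. *)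

(* Defs.v *)
From HB Require Import structures.
From mathcomp Require Import all_boot all_order all_algebra.
From mathcomp Require mpoly.

Set Implicit Arguments.
Unset Strict Implicit.
Unset Printing Implicit Defensive.

Import Order.TTheory GRing.Theory Num.Theory.
Local Open Scope ring_scope.

(* The notations of mpoly clash with those of mathcomp-analysis, which is
   imported below, so their use is confined to this module. *)
Module Harmonic.
Import mpoly.

Section Def.
Variables (R : comNzRingType) (d : nat).

Definition laplacian (P : {mpoly R[d]}) : {mpoly R[d]} :=
  \sum_(i < d) (P^`M(i))^`M(i).

(* Harm_l(R^d); as usual it contains the zero polynomial, for which
   [_ \is l.-homog] holds for every l. *)
Definition Harm (l : nat) (P : {mpoly R[d]}) : Prop :=
  P \is l.-homog /\ laplacian P = 0.

Definition evalp (P : {mpoly R[d]}) (x : 'rV[R]_d) : R := P.@[fun i => x ord0 i].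

End Def.
End Harmonic.

From mathcomp Require Import complex.
From mathcomp Require Import all_classical all_reals all_analysis.
Import numFieldNormedType.Exports.
Local Open Scope classical_set_scope.

Section Designs.
Variables (R : realType) (d : nat).

Definition sphere : set 'rV[R]_d := [set x | \sum_(i < d) x ord0 i ^+ 2 = 1].

(* [\sum_(x \in X)] is only meaningful for finite [X] (it is 0 when infinitely
   many terms are nonzero); see [finite_D4design] below. *)
Definition harmonic_sum_zero (X : set 'rV[R]_d) (l : nat) : Prop :=
  forall P, Harmonic.Harm l P -> \sum_(x \in X) Harmonic.evalp P x = 0.

Definition spherical_design (T : set nat) (X : set 'rV[R]_d) : Prop :=
  [/\ finite_set X, X !=set0, X `<=` sphere &
      forall l, T l -> harmonic_sum_zero X l].

Definition harmonic_strength (X : set 'rV[R]_d) : set nat :=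
  [set l | harmonic_sum_zero X l].

End Designs.

Definition D4 : set 'rV[int]_4 :=
  [set x | (2 %| \sum_(i < 4) x ord0 i)%Z].

Definition D4shell (n : nat) : set 'rV[int]_4 :=
  [set x | D4 x /\ \sum_(i < 4) x ord0 i ^+ 2 = n%:Z].

Definition D4design (R : realType) (m : nat) : set 'rV[R]_4 :=
  [set (Num.sqrt (2 * m)%N%:R)^-1 *: map_mx (fun a : int => a%:~R) x
     | x in D4shell (2 * m)%N].
Arguments D4design : clear implicits.

Lemma finite_D4shell (n : nat) : finite_set (D4shell n).
Proof.
pose f (v : {ffun 'I_4 -> 'I_(n + n).+1}) : 'rV[int]_4 :=
  \row_i ((v i : nat)%:Z - n%:Z).
apply: (@sub_finite_set _ _ (f @` setT)); last exact: finite_image.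
move=> x [_ xn]; have xb i : - n%:Z <= x ord0 i <= n%:Z.
  rewrite -ler_norml -abszE lez_nat; have: x ord0 i ^+ 2 <= n%:Z.
    rewrite -xn (bigD1 i)//= lerDl sumr_ge0// => j _; exact: sqr_ge0.
  rewrite -[x _ _ ^+ 2]ger0_norm ?sqr_ge0// normrX -abszE expr2 -PoszM lez_nat.
  by apply: leq_trans; case: `|x ord0 i|%N => // k; rewrite leq_pmulr.
exists [ffun i => inord (absz (x ord0 i + n%:Z))] => //.
apply/rowP => i; rewrite mxE ffunE.
have /andP[h1 h2] := xb i.
have h0 : 0 <= x ord0 i + n%:Z by rewrite -lerBlDr sub0r.
rewrite inordK; first by rewrite gez0_abs// addrK.
by rewrite ltnS -lez_nat gez0_abs// PoszD lerD2r.
Qed.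

Lemma finite_D4design (R : realType) (m : nat) : finite_set (D4design R m).
Proof. exact/finite_image/finite_D4shell. Qed.

Lemma D4design_sphere (R : realType) (m : nat) :
  (0 < m)%N -> D4design R m `<=` @sphere R 4.
Proof.
move=> m_gt0 _ [x [_ xm] <-]; rewrite /sphere/=.
have m0 : (2 * m)%:R != 0 :> R by rewrite pnatr_eq0 muln_eq0 -lt0n.
under eq_bigr do rewrite !mxE exprMn exprVn sqr_sqrtr ?ler0n//.
rewrite -mulr_sumr; under eq_bigr do rewrite -rmorphXn.
by rewrite -rmorph_sum/= xm mulVf.
Qed.

Section Eta.
Variable R : realType.
Local Notation C := R[i].

Definition cexp (z : C) : C :=
  (expR (complex.Re z))%:C%C * (cos (complex.Im z) +i* sin (complex.Im z))%C.

Definition two_pi_i : C := (0 +i* (2 * pi))%C.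

Definition nome (z : C) : C := cexp (two_pi_i * z).

(* [C^o] is [C] with the topology of its norm; the factor q^(1/24) is
   exp(2 pi i z / 24). *)
Definition eta (z : C) : C :=
  cexp (two_pi_i * z / 24) *
  lim ((fun N => \prod_(1 <= n < N.+1) (1 - nome z ^+ n) : C^o) @ \oo).

Definition eta8_eta8_coefficients (tau : nat -> int) : Prop :=
  forall z : C, 0 < complex.Im z ->
    (fun N => \sum_(1 <= m < N.+1) (tau m)%:~R * nome z ^+ m : C^o) @ \oo -->
    (eta z ^+ 8 * eta (2 * z) ^+ 8 : C^o).

End Eta.

(* Main.v *)
(* The average of a harmonic sextic over the signed permutations is a multiple of the
   unique invariant one, so the sums over a shell of D_4 of all harmonic sextics vanish
   as soon as one single weighted theta series, with nonzero average, has a vanishing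
   coefficient.  D_4 contains A_2 + A_2(2) with index 3; taking for weight a product of
   two harmonic cubics, one on each plane, factors the theta series as
   H(q) H(q^2), where H is the theta series of a coset of A_2 weighted by u1 u2 u3.

   That H is a multiple of the eighth power of f = prod (1 - q^n) follows from
   f H' = 8 f' H.  By the pentagonal number theorem the bracket f H' - 8 f' H is the
   theta series of a coset of A_3 weighted by a harmonic polynomial of degree 5, and it
   vanishes because S_4 has no harmonic invariant of degree 5.

   On the analytic side, the q-expansion of eta(z)^8 eta(2z)^8 is identified with the
   formal product by comparing both sides up to O(q^(N+1)) for small real q. *)

Require Import Defs.
From HB Require Import structures.
From mathcomp Require Import all_boot all_order all_algebra.
From mathcomp Require Import zify ring lra.
From mathcomp Require mpoly.

Set Implicit Arguments.
Unset Strict Implicit.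
Unset Printing Implicit Defensive.

Import Order.TTheory GRing.Theory Num.Theory.
Local Open Scope ring_scope.

(** * The pentagonal number theorem and eighth powers *)

Definition euler_poly (N : nat) : {poly int} := \prod_(1 <= i < N.+1) (1 - 'X^i).

(* Shanks' finite form of the pentagonal number theorem: this sum agrees with
   [euler_poly n] up to degree [n] and with the truncated pentagonal series. *)
Definition shanks (n : nat) : {poly int} :=
  \sum_(0 <= s < n.+1)
    (-1) ^+ s * (\prod_(s.+1 <= i < n.+1) (1 - 'X^i)) * 'X^(s * n + 'C(s.+1, 2)).

(** Passing to [n.+1] changes each old summand by a telescoping difference [V s.+1 - V s]. The two
    new monomials are the upper end [V n.+1] and the extra summand [s = n.+1]. *)
Lemma shanksS n :
  shanks n.+1 = shanks n + (-1) ^+ n.+1 *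
    ('X^(n.+1 * n.+1 + 'C(n.+2, 2)) + 'X^(n.+1 * n.+1 + 'C(n.+1, 2))).
Proof.
pose V s : {poly int} :=
  (-1) ^+ s * (\prod_(s <= i < n.+1) (1 - 'X^i)) * 'X^(s * n.+1 + 'C(s, 2)).
have step s : (s <= n)%N ->
    (-1) ^+ s * (\prod_(s.+1 <= i < n.+2) (1 - 'X^i)) * 'X^(s * n.+1 + 'C(s.+1, 2))
  = (-1) ^+ s * (\prod_(s.+1 <= i < n.+1) (1 - 'X^i)) * 'X^(s * n + 'C(s.+1, 2))
    + (V s.+1 - V s) :> {poly int}.
  move=> sn; rewrite /V big_nat_recr//=.
  rewrite [\prod_(s <= i < n.+1) _]big_ltn//=; set P := \prod_(s.+1 <= i < _) _.
  rewrite !binS !bin1.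
  have -> : (s * n.+1 + ('C(s, 2) + s) = s * n + 'C(s, 2) + s + s)%N by lia.
  have -> : (s * n + ('C(s, 2) + s) = s * n + 'C(s, 2) + s)%N by lia.
  have -> : (s.+1 * n.+1 + ('C(s, 2) + s) = s * n + 'C(s, 2) + s + s + n.+1)%N by lia.
  have -> : (s * n.+1 + 'C(s, 2) = s * n + 'C(s, 2) + s)%N by lia.
  rewrite !exprD !exprS; move: P ((-1) ^+ s) ('X^n) ('X^s) ('X^(s * n)) ('X^'C(s, 2)).
  by move=> P u v w x y; ring.
rewrite /shanks big_nat_recr//= (big_geq (leqnn _)).
rewrite (eq_big_nat _ _ (F2 := fun s => (-1) ^+ s * (\prod_(s.+1 <= i < n.+1)
   (1 - 'X^i)) * 'X^(s * n + 'C(s.+1, 2)) + (V s.+1 - V s))); last first.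
  by move=> s /andP[_ sn]; apply: step.
(* The factor [i = 0] of the product is [1 - 'X^0 = 0]. *)
have V0 : V 0%N = 0 by rewrite /V big_ltn// expr0 subrr mul0r mulr0 mul0r.
rewrite big_split/= telescope_sumr// V0 subr0 /V (big_geq (leqnn _)).
ring.
Qed.

Fixpoint int_ball (n : nat) : seq int :=
  if n is n'.+1 then n%:Z :: - n%:Z :: int_ball n' else [:: 0].

Lemma mem_int_ball n j : (j \in int_ball n) = (`|j| <= n)%N.
Proof. by elim: n => [|n IH]; rewrite !inE ?IH; lia. Qed.

Lemma int_ball_uniq n : uniq (int_ball n).
Proof.
by elim: n => [|n IH] //=; rewrite IH !inE !mem_int_ball; lia.
Qed.

Lemma two_bin2 n : ('C(n.+1, 2) * 2 = n * n.+1)%N.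
Proof. by elim: n => // n IH; rewrite binS bin1 mulnDl IH; lia. Qed.

(** The exponents added at stage [n.+1] are [j (3 j + 1) / 2] for [j = n.+1] and [j = - n.+1];
    doubling avoids the division. *)
Lemma shanks_coef n k :
  (shanks n)`_k = \sum_(j <- int_ball n | j * (3 * j + 1) == (2 * k)%:Z) (-1) ^+ `|j|%N.
Proof.
elim: n => [|n IH].
  rewrite /shanks big_nat1 big_geq// expr0 !mul1r coefXn.
  by rewrite big_mkcond big_seq1 mul0r; case: k.
rewrite shanksS coefD IH {IH} [in RHS]/= !big_cons.
have b1 := two_bin2 n; have b2 := two_bin2 n.+1.
have -> : ((-1) ^+ n.+1 : {poly int}) = ((-1) ^+ n.+1)%:P.
  by rewrite polyC_exp polyCN.
rewrite coefCM coefD !coefXn abszN absz_nat.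
have -> : (n.+1%:Z * (3 * n.+1%:Z + 1) == (2 * k)%:Z) =
          (k == n.+1 * n.+1 + 'C(n.+2, 2))%N by apply/eqP/eqP; lia.
have -> : (- n.+1%:Z * (3 * - n.+1%:Z + 1) == (2 * k)%:Z) =
          (k == n.+1 * n.+1 + 'C(n.+1, 2))%N by apply/eqP/eqP; lia.
by case: eqP; case: eqP => _ _ /=; ring.
Qed.

(** The summand [s = 0] of [shanks N] is [euler_poly N]; the others only have monomials of degree
    greater than [N]. *)
Lemma euler_poly_coef N k : (k <= N)%N ->
  (euler_poly N)`_k =
  \sum_(j <- int_ball N | j * (3 * j + 1) == (2 * k)%:Z) (-1) ^+ `|j|%N.
Proof.
move=> kN; rewrite -shanks_coef /shanks big_ltn// expr0 mul1r mulr1 coefD.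
rewrite [X in _ = _ + X]coef_sum [X in _ = _ + X]big1_seq ?addr0// => s.
rewrite mem_index_iota andTb => /andP[s1 _]; rewrite coefMXn.
case: ltnP => // h; have := two_bin2 s; nia.
Qed.

(* The recursion expresses [f A' = 8 f' A]. *)
Lemma eighth_power_rec_unique (N : nat) (e a b : nat -> int) : e 0%N = 1 ->
  (forall n, (n <= N)%N ->
     \sum_(k < n.+1) e k * a (n - k)%N * ((n - k)%N%:Z - 8 * k%:Z) = 0) ->
  (forall n, (n <= N)%N ->
     \sum_(k < n.+1) e k * b (n - k)%N * ((n - k)%N%:Z - 8 * k%:Z) = 0) ->
  forall n, (n <= N)%N -> a n * b 0%N = b n * a 0%N.
Proof.
move=> e0 ha hb; elim/ltn_ind => -[|n] IH nN; first by rewrite mulrC.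
have := hb _ nN; have := ha _ nN.
(* The term [k = 0] is [n.+1] times the top coefficient, which is thus determined by the lower
   ones. *)
rewrite !(@big_ord_recl _ _ _ n.+1) !e0 subn0 /=; set Sa := \sum_(i < _) _.
move=> /addr0_eq Ha; set Sb := \sum_(i < _) _; move=> /addr0_eq Hb.
have : Sa * b 0%N = Sb * a 0%N.
  rewrite !mulr_suml; apply: eq_bigr => i _; rewrite /bump /= add1n.
  have {}IH : a (n.+1 - i.+1)%N * b 0%N = b (n.+1 - i.+1)%N * a 0%N by apply: IH; lia.
  by rewrite mulrAC -[e _ * _ * b _]mulrA IH mulrA mulrAC.
rewrite -Ha -Hb => H; apply: (@mulfI _ n.+1%:Z) => //; lia.
Qed.

(** Since [X d/dX] multiplies the coefficient of index [i] by [i], this is one coefficient of the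
    chain rule for [f ^+ 8], multiplied by [f]. *)
Lemma exp8_rec (f : {poly int}) n :
  \sum_(k < n.+1) f`_k * (f ^+ 8)`_(n - k)%N * ((n - k)%N%:Z - 8 * k%:Z) = 0.
Proof.
have D (p : {poly int}) i : ('X * p^`())`_i = p`_i * i%:Z.
  by rewrite coefXM coef_deriv; case: i => [|i] /=; rewrite ?mulr0// -mulr_natr natz.
have E : f * ('X * (f ^+ 8)^`()) - 8 *: (('X * f^`()) * f ^+ 8) = 0.
  rewrite deriv_exp /=; rewrite -mulr_natr scaler_nat -[_ *+ 8]mulr_natr; ring.
have := congr1 (fun p : {poly int} => p`_n) E.
rewrite coef0 coefB coefZ !coefM mulr_sumr -sumrB => {}E; rewrite -[RHS]E.
by apply: eq_bigr => i _; rewrite !D; ring.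
Qed.

(** * Harmonic sextics in four variables *)

Module HarmonicSextics.
Import mpoly.

Lemma big_ord4 (V : Type) (idx : V) (op : Monoid.law idx) (F : 'I_4 -> V) :
  \big[op/idx]_i F i = op (op (op (F 0) (F 1)) (F 2)) (F 3).
Proof.
rewrite !big_ord_recl big_ord0 Monoid.mulm1 !Monoid.mulmA.
by congr (op (op (op (F _) (F _)) (F _)) (F _)); apply: val_inj.
Qed.

Lemma mderiv2X (R : comNzRingType) (n : nat) (m : 'X_{1..n}) (i : 'I_n) :
  ('X_[m] : {mpoly R[n]})^`M(i)^`M(i) = (m i * (m i).-1)%:R *: 'X_[m - U_(i) - U_(i)].
Proof.
by rewrite !mderivX linearZ /= mderivX scalerA mnmBE mnm1E eqxx subn1 natrM.
Qed.

Section Moments.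
Variables (R : numFieldType) (s : seq 'rV[R]_4).

Definition moment (a b c d : nat) : R :=
  \sum_(x <- s) x ord0 0 ^+ a * x ord0 1 ^+ b * x ord0 2 ^+ c * x ord0 3 ^+ d.

Hypothesis moment_odd : forall a b c d,
  [|| odd a, odd b, odd c | odd d] -> moment a b c d = 0.
Hypothesis moment01 : forall a b c d, moment a b c d = moment b a c d.
Hypothesis moment12 : forall a b c d, moment a b c d = moment a c b d.
Hypothesis moment23 : forall a b c d, moment a b c d = moment a b d c.
(** By the symmetries, four times this expression is the sum over [s] of the invariant sextic
    [b4sextic_mpoly]. *)
Hypothesis moment_sextic :
  moment 6 0 0 0 - 15 * moment 4 2 0 0 + 30 * moment 2 2 2 0 = 0.

(* The functional on quartic monomials whose composition with the Laplacian is
   the sum of the values on [s]. *)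
Let phi (a b c d : nat) : R :=
  if [|| odd a, odd b, odd c | odd d] then 0
  else if [|| a == 4, b == 4, c == 4 | d == 4] then moment 6 0 0 0 / 30
  else moment 2 2 2 0 / 6.

(** Up to order, an even sextic monomial has exponents 6, 42 or 222. The types 6 and 222 dictate the
    two values of [phi] on even monomials, and the type 42 is then [moment_sextic]. Where [.-2]
    truncates, the coefficient is zero. *)
Let moment_phi (a b c d : nat) : (a + b + c + d = 6)%N ->
  moment a b c d =
    (a * a.-1)%:R * phi a.-2 b c d + (b * b.-1)%:R * phi a b.-2 c d +
    (c * c.-1)%:R * phi a b c.-2 d + (d * d.-1)%:R * phi a b c d.-2.
Proof.
move=> sum6; case: (boolP [|| odd a, odd b, odd c | odd d]) => [oddm|].
  rewrite moment_odd// /phi.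
  (* Truncation may turn an odd exponent 1 into 0, but the degree is even, so there is a second odd
     exponent and [phi] still vanishes. *)
  case: ifPn => [_|]; last by move: oddm sum6; lia.
  case: ifPn => [_|]; last by move: oddm sum6; lia.
  case: ifPn => [_|]; last by move: oddm sum6; lia.
  case: ifPn => [_|]; last by move: oddm sum6; lia.
  by rewrite !mulr0 !addr0.
rewrite !negb_or => /and4P[a2 b2 c2 d2].
pose a' := a./2; pose b' := b./2; pose c' := c./2; pose d' := d./2.
have [aE bE] : a = a'.*2 /\ b = b'.*2 by rewrite /a' /b'; lia.
have [cE dE] : c = c'.*2 /\ d = d'.*2 by rewrite /c' /d'; lia.
have {}sum6 : (a' + b' + c' + d' = 3)%N by lia.
move: a' b' c' d' aE bE cE dE sum6 => a' b' c' d' -> -> -> -> {a b c d a2 b2 c2 d2}.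
have m6 : moment 6 0 0 0 = 15 * moment 4 2 0 0 - 30 * moment 2 2 2 0.
  by apply/eqP; rewrite -subr_eq0 -moment_sextic; apply/eqP; ring.
have E42 : moment 4 2 0 0 = 12 * (moment 2 2 2 0 / 6) + 2 * (moment 6 0 0 0 / 30).
  by rewrite m6; field.
have m0006 : moment 0 0 0 6 = moment 6 0 0 0.
  by rewrite (moment23 0 0 0 6) (moment12 0 0 6 0) (moment01 0 6 0 0).
have m0060 : moment 0 0 6 0 = moment 6 0 0 0.
  by rewrite (moment12 0 0 6 0) (moment01 0 6 0 0).
have m0600 : moment 0 6 0 0 = moment 6 0 0 0.
  by rewrite (moment01 0 6 0 0).
have m0024 : moment 0 0 2 4 = moment 4 2 0 0.
  by rewrite (moment12 0 0 2 4) (moment01 0 2 0 4) (moment23 2 0 0 4)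
    (moment12 2 0 4 0) (moment01 2 4 0 0).
have m0042 : moment 0 0 4 2 = moment 4 2 0 0.
  by rewrite (moment12 0 0 4 2) (moment01 0 4 0 2) (moment23 4 0 0 2) (moment12 4 0 2 0).
have m0204 : moment 0 2 0 4 = moment 4 2 0 0.
  by rewrite (moment01 0 2 0 4) (moment23 2 0 0 4) (moment12 2 0 4 0) (moment01 2 4 0 0).
have m0240 : moment 0 2 4 0 = moment 4 2 0 0.
  by rewrite (moment01 0 2 4 0) (moment12 2 0 4 0) (moment01 2 4 0 0).
have m0402 : moment 0 4 0 2 = moment 4 2 0 0.
  by rewrite (moment01 0 4 0 2) (moment23 4 0 0 2) (moment12 4 0 2 0).
have m0420 : moment 0 4 2 0 = moment 4 2 0 0.
  by rewrite (moment01 0 4 2 0) (moment12 4 0 2 0).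
have m2004 : moment 2 0 0 4 = moment 4 2 0 0.
  by rewrite (moment23 2 0 0 4) (moment12 2 0 4 0) (moment01 2 4 0 0).
have m2040 : moment 2 0 4 0 = moment 4 2 0 0.
  by rewrite (moment12 2 0 4 0) (moment01 2 4 0 0).
have m2400 : moment 2 4 0 0 = moment 4 2 0 0.
  by rewrite (moment01 2 4 0 0).
have m4002 : moment 4 0 0 2 = moment 4 2 0 0.
  by rewrite (moment23 4 0 0 2) (moment12 4 0 2 0).
have m4020 : moment 4 0 2 0 = moment 4 2 0 0.
  by rewrite (moment12 4 0 2 0).
have m0222 : moment 0 2 2 2 = moment 2 2 2 0.
  by rewrite (moment01 0 2 2 2) (moment12 2 0 2 2) (moment23 2 2 0 2).
have m2022 : moment 2 0 2 2 = moment 2 2 2 0.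
  by rewrite (moment12 2 0 2 2) (moment23 2 2 0 2).
have m2202 : moment 2 2 0 2 = moment 2 2 2 0.
  by rewrite (moment23 2 2 0 2).
have dE : ((0.*2 = 0%N) * (1.*2 = 2%N) * (2.*2 = 4%N) * (3.*2 = 6%N))%type by [].
pose mE := (m0006, m0060, m0600, m0024, m0042, m0204, m0240, m0402, m0420,
  m2004, m2040, m2400, m4002, m4020, m0222, m2022, m2202).
case: a' => [|[|[|[|a']]]]; case: b' => [|[|[|[|b']]]]; case: c' => [|[|[|[|c']]]];
  case: d' => [|[|[|[|d']]]] //= _; by rewrite /phi /= ?dE ?mE ?E42; field.
Qed.

(** The sum over [s] factors through the Laplacian: by [moment_phi] it equals [ell (laplacian _)] on
    sextic monomials, where [ell] extends [phi] linearly. *)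
Lemma harmonic_sextic_sum (P : {mpoly R[4]}) :
  Harmonic.Harm 6 P -> \sum_(x <- s) Harmonic.evalp P x = 0.
Proof.
move=> [Phom lapP].
pose ell (Q : {mpoly R[4]}) : R :=
  \sum_(k : 'X_{1..4 < 7}) Q@_k * phi ((k : 'X_{1..4}) 0) ((k : 'X_{1..4}) 1)
     ((k : 'X_{1..4}) 2) ((k : 'X_{1..4}) 3).
have ellD Q1 Q2 : ell (Q1 + Q2) = ell Q1 + ell Q2.
  by rewrite /ell -big_split; apply: eq_bigr => k _; rewrite mcoeffD mulrDl.
have ellZ c Q : ell (c *: Q) = c * ell Q.
  by rewrite /ell mulr_sumr; apply: eq_bigr => k _; rewrite mcoeffZ mulrA.
have ell0 : ell 0 = 0 by rewrite -(scale0r (0 : {mpoly R[4]})) ellZ mul0r.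
have ell_sum (I : Type) (r : seq I) (F : I -> {mpoly R[4]}) :
    ell (\sum_(i <- r) F i) = \sum_(i <- r) ell (F i).
  by elim/big_rec2: _ => // i y1 y2 _ <-; rewrite ellD.
have ellX (m : 'X_{1..4}) : (mdeg m < 7)%N -> ell 'X_[m] = phi (m 0) (m 1) (m 2) (m 3).
  move=> m7; rewrite /ell (bigD1 (BMultinom m7))//= mcoeffX eqxx mul1r big1 ?addr0//.
  move=> k; rewrite -val_eqE /= mcoeffX eq_sym => /negbTE ->; exact: mul0r.
have lapX (m : 'X_{1..4}) : mdeg m = 6%N ->
    \sum_(x <- s) Harmonic.evalp 'X_[m] x = ell (Harmonic.laplacian 'X_[m]).
  move=> m6; have sum6 : (m 0%R + m 1%R + m 2%R + m 3%R = 6)%N by rewrite -m6 mdegE big_ord4.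
  rewrite /Harmonic.laplacian ell_sum big_ord4 !mderiv2X !ellZ.
  have deg i : (mdeg (m - U_(i) - U_(i)) < 7)%N.
    rewrite ltnS -m6 !mdegE leq_sum// => j _.
    by rewrite !mnmBE (leq_trans (leq_subr _ _))// leq_subr.
  rewrite !ellX// !mnmBE !mnm1E /= !subn0 !subn1.
  rewrite -(moment_phi sum6); apply: eq_bigr => x _.
  by rewrite /Harmonic.evalp mevalX big_ord4.
have -> : \sum_(x <- s) Harmonic.evalp P x =
    \sum_(m <- msupp P) P@_m * \sum_(x <- s) Harmonic.evalp 'X_[m] x.
  rewrite [X in Harmonic.evalp X]mpolyE /Harmonic.evalp.
  under [RHS]eq_bigr do rewrite mulr_sumr; rewrite [RHS]exchange_big /=.
  apply: eq_bigr => x _; rewrite raddf_sum /=.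
  by apply: eq_bigr => m _; rewrite mevalZ.
have D2 i : P^`M(i)^`M(i) = \sum_(m <- msupp P) P@_m *: 'X_[m]^`M(i)^`M(i).
  have -> : P^`M(i) = \sum_(m <- msupp P) P@_m *: 'X_[m]^`M(i).
    rewrite {1}(mpolyE P) (raddf_sum (mderiv i)) /=.
    by apply: eq_bigr => m _; rewrite mderivZ.
  rewrite (raddf_sum (mderiv i)) /=.
  by apply: eq_bigr => m _; rewrite mderivZ.
rewrite -[RHS]ell0 -lapP /Harmonic.laplacian.
under [in RHS]eq_bigr => i _ do rewrite D2.
rewrite [X in ell X]exchange_big ell_sum /= big_seq [RHS]big_seq.
apply: eq_bigr => m mP; rewrite lapX; last by move/dhomogP: Phom => /(_ m mP).
by rewrite -ellZ; congr ell; rewrite scaler_sumr.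
Qed.

End Moments.

Section InvariantSextic.
Variable R : comNzRingType.

Definition b4sextic_mpoly : {mpoly R[4]} :=
  let: (a, b, c, d) := ('X_0, 'X_1, 'X_2, 'X_3) in
  a ^+ 6 + b ^+ 6 + c ^+ 6 + d ^+ 6
  - 5%:R * (a ^+ 4 * (b ^+ 2 + c ^+ 2 + d ^+ 2) + b ^+ 4 * (a ^+ 2 + c ^+ 2 + d ^+ 2)
       + c ^+ 4 * (a ^+ 2 + b ^+ 2 + d ^+ 2) + d ^+ 4 * (a ^+ 2 + b ^+ 2 + c ^+ 2))
  + 30%:R * (a ^+ 2 * b ^+ 2 * c ^+ 2 + a ^+ 2 * b ^+ 2 * d ^+ 2
        + a ^+ 2 * c ^+ 2 * d ^+ 2 + b ^+ 2 * c ^+ 2 * d ^+ 2).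

Lemma b4sextic_mpoly_harmonic : Harmonic.Harm 6 b4sextic_mpoly.
Proof.
split.
  have hX i n : ('X_i : {mpoly R[4]}) ^+ n \is n.-homog.
    by rewrite mpolyXn dhomogX /= mdegMn mdeg1 mul1n.
  have h42 i j k l : ('X_i : {mpoly R[4]}) ^+ 4 * ('X_j ^+ 2 + 'X_k ^+ 2 + 'X_l ^+ 2)
      \is 6.-homog.
    by apply: (dhomogM (hX i 4%N)); rewrite !rpredD.
  have h222 i j k : ('X_i : {mpoly R[4]}) ^+ 2 * 'X_j ^+ 2 * 'X_k ^+ 2 \is 6.-homog.
    exact: (dhomogM (dhomogM (hX i 2%N) (hX j 2%N)) (hX k 2%N)).
  rewrite /b4sextic_mpoly !mulr_natl.
  apply: rpredD; last by apply: rpredMn; rewrite !rpredD.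
  apply: rpredB; last by apply: rpredMn; rewrite !rpredD.
  by rewrite !rpredD.
have dX (i j : 'I_4) : ('X_i : {mpoly R[4]})^`M(j) = (i == j)%:R.
  rewrite mderivX mnm1E; case: eqP => [->|_]; last by rewrite scale0r.
  rewrite scale1r -mpolyX0; congr 'X_[_].
  by apply/mnmP => k; rewrite mnmBE subnn mnm0E.
have dnat (n : nat) j : (n%:R : {mpoly R[4]})^`M(j) = 0.
  by rewrite -mpolyC_nat mderivC.
have dXn (i : 'I_4) n :
    (('X_i : {mpoly R[4]}) ^+ n.+1)^`M(i) = n.+1%:R * 'X_i ^+ n.
  elim: n => [|n IH]; first by rewrite expr1 dX eqxx mulr1.
  rewrite exprS mderivM IH dX eqxx mul1r -[n.+2%:R]natr1 mulrDl mul1r addrC.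
  by rewrite mulrCA -exprS.
have dXn0 (i j : 'I_4) n : j != i -> (('X_j : {mpoly R[4]}) ^+ n)^`M(i) = 0.
  move=> ji; elim: n => [|n IH]; first by rewrite expr0 (dnat 1%N).
  by rewrite exprS mderivM IH dX (negbTE ji) mul0r mulr0 addr0.
(* Second derivative of a sextic even in ['X_i], its coefficients [A], [B], [C] being free of
   ['X_i]. *)
have d2 i (A B C : {mpoly R[4]}) : A^`M(i) = 0 -> B^`M(i) = 0 -> C^`M(i) = 0 ->
    ('X_i ^+ 6 + 'X_i ^+ 4 * A + 'X_i ^+ 2 * B + C)^`M(i)^`M(i) =
    30%:R * 'X_i ^+ 4 + 12%:R * ('X_i ^+ 2 * A) + 2%:R * B.
  move=> hA hB hC.
  have -> : ('X_i ^+ 6 + 'X_i ^+ 4 * A + 'X_i ^+ 2 * B + C)^`M(i) =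
      6%:R * 'X_i ^+ 5 + 4%:R * ('X_i ^+ 3 * A) + 2%:R * ('X_i ^+ 1 * B).
    rewrite 3!mderivD (mderivM i ('X_i ^+ 4) A) (mderivM i ('X_i ^+ 2) B) hA hB hC.
    by rewrite !dXn !mulr0 !addr0 !mulrA.
  have dM n (Q : {mpoly R[4]}) : (n%:R * Q)^`M(i) = n%:R * Q^`M(i).
    by rewrite mderivM dnat mul0r add0r.
  rewrite 2!mderivD !dM (mderivM i ('X_i ^+ 3) A) (mderivM i ('X_i ^+ 1) B) hA hB.
  by rewrite !dXn !mulr0 !addr0; ring.
(* The invariant sextic sorted by powers of its first argument; by symmetry it serves for each of
   the four variables. *)
pose S (a b c d : {mpoly R[4]}) := a ^+ 6 + a ^+ 4 * (- 5%:R * (b ^+ 2 + c ^+ 2 + d ^+ 2))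
  + a ^+ 2 * (30%:R * (b ^+ 2 * c ^+ 2 + b ^+ 2 * d ^+ 2 + c ^+ 2 * d ^+ 2)
              - 5%:R * (b ^+ 4 + c ^+ 4 + d ^+ 4))
  + (b ^+ 6 + c ^+ 6 + d ^+ 6 - 5%:R * (b ^+ 4 * (c ^+ 2 + d ^+ 2)
      + c ^+ 4 * (b ^+ 2 + d ^+ 2) + d ^+ 4 * (b ^+ 2 + c ^+ 2))
     + 30%:R * (b ^+ 2 * c ^+ 2 * d ^+ 2)).
have dS i j k l : j != i -> k != i -> l != i ->
    (S 'X_i 'X_j 'X_k 'X_l)^`M(i)^`M(i) =
    30%:R * 'X_i ^+ 4 + 12%:R * ('X_i ^+ 2 *
      (- 5%:R * ('X_j ^+ 2 + 'X_k ^+ 2 + 'X_l ^+ 2))) + 2%:R *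
      (30%:R * ('X_j ^+ 2 * 'X_k ^+ 2 + 'X_j ^+ 2 * 'X_l ^+ 2 + 'X_k ^+ 2 * 'X_l ^+ 2)
              - 5%:R * ('X_j ^+ 4 + 'X_k ^+ 4 + 'X_l ^+ 4)).
  move=> ji ki li; apply: d2;
    by do ![rewrite dXn0//|rewrite dnat|rewrite mderivB|rewrite mderivD|rewrite mderivN
           |rewrite mderivM]; rewrite ?oppr0 !(mul0r, mulr0, addr0, subr0).
rewrite /Harmonic.laplacian big_ord4 /=.
have -> : b4sextic_mpoly^`M(0)^`M(0) = (S 'X_0 'X_1 'X_2 'X_3)^`M(0)^`M(0).
  by do 2!congr mderiv; rewrite /b4sextic_mpoly /S; ring.
have -> : b4sextic_mpoly^`M(1)^`M(1) = (S 'X_1 'X_0 'X_2 'X_3)^`M(1)^`M(1).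
  by do 2!congr mderiv; rewrite /b4sextic_mpoly /S; ring.
have -> : b4sextic_mpoly^`M(2)^`M(2) = (S 'X_2 'X_1 'X_0 'X_3)^`M(2)^`M(2).
  by do 2!congr mderiv; rewrite /b4sextic_mpoly /S; ring.
have -> : b4sextic_mpoly^`M(3)^`M(3) = (S 'X_3 'X_1 'X_2 'X_0)^`M(3)^`M(3).
  by do 2!congr mderiv; rewrite /b4sextic_mpoly /S; ring.
by rewrite !dS//; ring.
Qed.

Lemma b4sextic_mpoly_eval (x : 'rV[R]_4) :
  Harmonic.evalp b4sextic_mpoly x =
  let: (a, b, c, d) := (x ord0 0, x ord0 1, x ord0 2, x ord0 3) in
  a ^+ 6 + b ^+ 6 + c ^+ 6 + d ^+ 6
  - 5 * (a ^+ 4 * (b ^+ 2 + c ^+ 2 + d ^+ 2) + b ^+ 4 * (a ^+ 2 + c ^+ 2 + d ^+ 2)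
       + c ^+ 4 * (a ^+ 2 + b ^+ 2 + d ^+ 2) + d ^+ 4 * (a ^+ 2 + b ^+ 2 + c ^+ 2))
  + 30 * (a ^+ 2 * b ^+ 2 * c ^+ 2 + a ^+ 2 * b ^+ 2 * d ^+ 2
        + a ^+ 2 * c ^+ 2 * d ^+ 2 + b ^+ 2 * c ^+ 2 * d ^+ 2).
Proof.
rewrite /Harmonic.evalp /b4sextic_mpoly.
set v := (X in _.@[X]).
have vX i n : (('X_i : {mpoly R[4]}) ^+ n).@[v] = x ord0 i ^+ n.
  by rewrite rmorphXn /= mevalXU.
have vn n : (n%:R : {mpoly R[4]}).@[v] = n%:R by rewrite rmorph_nat.
by rewrite !(vX, vn, mevalB, mevalD, mevalM).
Qed.

End InvariantSextic.
End HarmonicSextics.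

From mathcomp Require Import complex.
From mathcomp Require Import all_classical all_reals all_analysis.
Import numFieldNormedType.Exports.
Local Open Scope classical_set_scope.

(** * Lattice sums *)

Lemma fsum_can (V : zmodType) (T U : choiceType) (A : set T) (B : set U)
    (h : T -> U) (g : U -> T) (F : T -> V) (G : U -> V) :
  (forall x, A x -> B (h x)) -> (forall y, B y -> A (g y)) ->
  (forall x, A x -> g (h x) = x) -> (forall y, B y -> h (g y) = y) ->
  (forall x, A x -> F x = G (h x)) ->
  \sum_(x \in A) F x = \sum_(y \in B) G y.
Proof.
move=> hAB gBA ghK hgK FG; rewrite (reindex_fsbig h A B).
  by apply: eq_fsbigr => x /set_mem/FG.
split=> [x|x y|y]; first exact: hAB.
  by move=> /set_mem/ghK {2}<- /set_mem/ghK {2}<- ->.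
by move=> By; exists (g y); [exact: gBA|exact: hgK].
Qed.

Lemma fsumD (V : zmodType) (T : choiceType) (A : set T) (F G : T -> V) :
  finite_set A ->
  \sum_(x \in A) (F x + G x) = \sum_(x \in A) F x + \sum_(x \in A) G x.
Proof. exact: fsbig_split. Qed.

Lemma fsum_eq0_anti (T : choiceType) (A : set T) (h : T -> T) (F : T -> int) :
  (forall x, A x -> A (h x)) -> (forall x, A x -> h (h x) = x) ->
  (forall x, A x -> F (h x) = - F x) -> \sum_(x \in A) F x = 0.
Proof.
move=> hA hK hF; have : \sum_(x \in A) F x = - \sum_(x \in A) F x.
  transitivity (\sum_(x \in A) (- F x)).
    apply: (fsum_can (h := h) (g := h)) => // x Ax.
    by rewrite hF ?opprK.
  by rewrite -[RHS]mulN1r mulr_fsumr; apply: eq_fsbigr => x _; rewrite mulN1r.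
by lia.
Qed.

(** A Cauchy product of theta series. The weight [F] couples both arguments, so as to include
    brackets, whose weight mixes the two norms. *)
Lemma fsum_conv (T U : choiceType) (phi : T -> int) (psi : U -> int)
    (F : T -> U -> int) (n : nat) :
  (forall x, 0 <= phi x) -> (forall y, 0 <= psi y) ->
  (forall k : nat, finite_set [set x | phi x <= k%:Z]) ->
  (forall k : nat, finite_set [set y | psi y <= k%:Z]) ->
  \sum_(k < n.+1) \sum_(x \in [set x | phi x = k%:Z])
     \sum_(y \in [set y | psi y = (n - k)%N%:Z]) F x y =
  \sum_(z \in [set z | phi z.1 + psi z.2 = n%:Z]) F z.1 z.2.
Proof.
move=> phi0 psi0 finphi finpsi.
pose Z := [set z | phi z.1 + psi z.2 = n%:Z].
have finZ : finite_set Z.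
  apply: (@sub_finite_set _ _ ([set x | phi x <= n%:Z] `*` [set y | psi y <= n%:Z])).
    by move=> [x y]; rewrite /Z /= => h; have := phi0 x; have := psi0 y; split; lia.
  exact: finite_setX.
pose K (k : nat) := [set z : T * U | phi z.1 = k%:Z].
transitivity (\sum_(k < n.+1) \sum_(z \in Z `&` K k) F z.1 z.2).
  apply: eq_bigr => k _; rewrite pair_fsbig; first last.
  - by apply: sub_finite_set (finpsi (n - k)%N) => y /= ->.
  - by apply: sub_finite_set (finphi k) => y /= ->.
  apply: eq_fsbigl; apply/seteqP; have := ltn_ord k.
  by split=> -[x y] /= []; rewrite /Z /K /=; lia.
under eq_bigr do rewrite fsbig_mkcondr fsbig_finite//.
rewrite [RHS]fsbig_finite// exchange_big/=; apply: eq_big_seq => -[x y].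
rewrite in_fset_set// => /set_mem; rewrite /Z /= => xyZ.
have := phi0 x; have := psi0 y => hy hx.
have xn : (`|phi x| < n.+1)%N by lia.
rewrite (bigD1 (Ordinal xn))//= big1 ?addr0; last first.
  move=> i; rewrite -val_eqE /= => ni; case: ifPn => // /set_mem.
  by rewrite /K /=; lia.
by rewrite ifT//; apply/mem_set; rewrite /K /=; lia.
Qed.

Lemma finite_int_ball (n : nat) : finite_set [set j : int | (`|j| <= n)%N].
Proof.
apply: (@sub_finite_set _ _ [set` int_ball n]) => [j /=|]; first by rewrite mem_int_ball.
exact: finite_seq.
Qed.

(** With [u = (3 x + 1, 3 y + 1, - 3 x - 3 y - 2)], where [u / 3] runs over a nontrivial coset of
    A_2, this is [(|u|^2 - 6) / 18]. *)
Definition a2form (z : int * int) : int :=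
  z.1 * z.1 + z.1 * z.2 + z.2 * z.2 + z.1 + z.2.

(** The product [u1 u2 u3], harmonic on the plane of A_2. *)
Definition a2cubic (z : int * int) : int :=
  - ((3 * z.1 + 1) * (3 * z.2 + 1) * (3 * z.1 + 3 * z.2 + 2)).

Definition a2theta (k : nat) : int :=
  \sum_(z \in [set z | a2form z = k%:Z]) a2cubic z.

Definition pentagonal (j : int) : int := (j * (3 * j + 1) %/ 2)%Z.

Definition pentagonal_coef (k : nat) : int :=
  \sum_(j \in [set j | pentagonal j = k%:Z]) ((-1) ^+ `|j|%N : int).

Lemma pentagonalE j : 2 * pentagonal j = j * (3 * j + 1).
Proof.
rewrite /pentagonal; have : (j %% 2)%Z = 0 \/ (j %% 2)%Z = 1 by lia.
case=> h; have := divz_eq j 2; rewrite h; set c := (j %/ 2)%Z => ->.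
  have -> : (c * 2 + 0) * (3 * (c * 2 + 0) + 1) = c * (3 * (c * 2) + 1) * 2 by ring.
  by rewrite mulzK//; ring.
have -> : (c * 2 + 1) * (3 * (c * 2 + 1) + 1) = (c * 2 + 1) * (3 * c + 2) * 2 by ring.
by rewrite mulzK//; ring.
Qed.

Lemma pentagonal_ge0 j : 0 <= pentagonal j.
Proof.
by have := pentagonalE j; have [|] : 0 <= j \/ j <= -1 by [lia]; nia.
Qed.

Lemma a2form_ge0 z : 0 <= a2form z.
Proof.
case: z => x y; rewrite /a2form /=.
(* For integral [y] the remainder [(3 y - 1) (y + 1)] is negative only at [y = 0], where the form is
   [x (x + 1)]. *)
have : 4 * (x * x + x * y + y * y + x + y) =
   (2 * x + y + 1) * (2 * x + y + 1) + (3 * y - 1) * (y + 1) by ring.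
have := sqr_ge0 (2 * x + y + 1); rewrite expr2.
have [->|[|]] : y = 0 \/ 1 <= y \/ y <= -1 by lia.
- by have [|] : 0 <= x \/ x <= -1 by [lia]; nia.
- by nia.
- by nia.
Qed.

Lemma finite_pentagonal (k : nat) : finite_set [set j | pentagonal j <= k%:Z].
Proof.
apply: sub_finite_set (finite_int_ball k) => j /=; have := pentagonalE j.
by have [|] : 0 <= j \/ j <= -1 by [lia]; nia.
Qed.

Lemma finite_a2form (k : nat) : finite_set [set z | a2form z <= k%:Z].
Proof.
apply: sub_finite_set (finite_setX (finite_int_ball (2 * k).+1)
  (finite_int_ball (2 * k).+1)) => -[x y] /=; rewrite /a2form/=.
move=> xyk; have Hx : 4 * (x * x + x * y + y * y + x + y) =
   (2 * x + y + 1) ^+ 2 + 3 * y * y + 2 * y - 1 by ring.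
have Hy : 4 * (x * x + x * y + y * y + x + y) =
   (2 * y + x + 1) ^+ 2 + 3 * x * x + 2 * x - 1 by ring.
have := sqr_ge0 (2 * x + y + 1); have := sqr_ge0 (2 * y + x + 1).
move: Hx Hy; set u := _ ^+ 2; set v := _ ^+ 2 => Hx Hy hv hu.
have hx : 3 * x * x + 2 * x <= 4 * k%:Z + 1 by lia.
have hy : 3 * y * y + 2 * y <= 4 * k%:Z + 1 by lia.
clear -hx hy; split => /=.
  by have [|] : 0 <= x \/ x <= -1 by [lia]; nia.
by have [|] : 0 <= y \/ y <= -1 by [lia]; nia.
Qed.

(** Since [|j| <= pentagonal j], cutting off at [|j| <= N] loses no exponent up to [N]. *)
Lemma euler_poly_pentagonal N k : (k <= N)%N -> (euler_poly N)`_k = pentagonal_coef k.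
Proof.
move=> kN; rewrite euler_poly_coef// -big_filter fsbig_seq ?filter_uniq ?int_ball_uniq//.
apply: eq_fsbigl; apply/seteqP; split=> j /=; rewrite mem_filter mem_int_ball.
  by move=> /andP[/eqP h _]; have := pentagonalE j; lia.
move=> h; have := pentagonalE j.
by have [|] : 0 <= j \/ j <= -1 by [lia]; nia.
Qed.

(** * The weighted theta series of A_2 *)

(* The point [(b1, b2, b3)] stands for the vector [(b1, b2, b3, b4)] of
   coordinate sum [-1]; [4 b + 1] runs over a coset of [A_3] in its dual. *)
Definition a3last (b : int * int * int) : int := -1 - b.1.1 - b.1.2 - b.2.

Definition a3shell (n : nat) : set (int * int * int) :=
  [set b | b.1.1 * b.1.1 + b.1.2 * b.1.2 + b.2 * b.2 + a3last b * a3last b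
           = 2 * n%:Z + 1].

(** The first three factors are, up to a common sign, the coordinates of [u]. The last one is
    [n - 9 p] with [24 p + 1 = (4 b4 + 1)^2], which is the bracket weight [a2form - 8 p] when
    [a2form + p = n]. *)
Definition a3poly (n : nat) (b : int * int * int) : int :=
  (3 * b.1.1 + a3last b + 1) * (3 * b.1.2 + a3last b + 1) *
  (3 * b.2 + a3last b + 1) * (n%:Z - 6 * (a3last b * a3last b) - 3 * a3last b).

Lemma finite_a3shell n : finite_set (a3shell n).
Proof.
pose B := finite_int_ball (2 * n + 1).
apply: sub_finite_set (finite_setX (finite_setX B B) B) => -[[x y] z].
by rewrite /a3shell/=; move: (a3last _) => t h; split; [split|] => /=; nia.
Qed.

(* There is no nonzero harmonic polynomial of degree 5 invariant under S_4. *)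
Lemma a3poly_sum n : \sum_(b \in a3shell n) a3poly n b = 0.
Proof.
(* As [a3poly] is symmetric in [b1], [b2], [b3], the exchanges of each of them with [b4] produce the
   full average over S_4. *)
pose s1 (b : int * int * int) := (a3last b, b.1.2, b.2).
pose s2 (b : int * int * int) := (b.1.1, a3last b, b.2).
pose s3 (b : int * int * int) := (b.1.1, b.1.2, a3last b).
have E s : (forall b, a3shell n b -> a3shell n (s b)) -> (forall b, s (s b) = b) ->
    \sum_(b \in a3shell n) a3poly n (s b) = \sum_(b \in a3shell n) a3poly n b.
  move=> sD sK; apply: (fsum_can (h := s) (g := s)) => //.
have E1 : \sum_(b \in a3shell n) a3poly n (s1 b) = \sum_(b \in a3shell n) a3poly n b.
  apply: E => -[[x y] z]; rewrite /s1 /a3shell /a3last/=; first by lia.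
  by congr (_, _, _); lia.
have E2 : \sum_(b \in a3shell n) a3poly n (s2 b) = \sum_(b \in a3shell n) a3poly n b.
  apply: E => -[[x y] z]; rewrite /s2 /a3shell /a3last/=; first by lia.
  by congr (_, _, _); lia.
have E3 : \sum_(b \in a3shell n) a3poly n (s3 b) = \sum_(b \in a3shell n) a3poly n b.
  apply: E => -[[x y] z]; rewrite /s3 /a3shell /a3last/=; first by lia.
  by congr (_, _, _); lia.
have : \sum_(b \in a3shell n) (a3poly n b + a3poly n (s1 b) + a3poly n (s2 b)
    + a3poly n (s3 b)) = 0.
  apply: fsbig1 => -[[x y] z].
  rewrite /a3shell /a3poly /s1 /s2 /s3 /a3last/= => h.
  (* Doubling makes [2 n] appear, which the shell equation expresses through [b]. *)
  apply: (@mulfI _ 2) => //; rewrite mulr0.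
  have h2 : 2 * n%:Z = x * x + y * y + z * z + (-1 - x - y - z) * (-1 - x - y - z) - 1 by lia.
  have dist (A B C D : int) : 2 * (A + B + C + D) = 2 * A + 2 * B + 2 * C + 2 * D by ring.
  have pull u v w N : 2 * (u * v * w * (n%:Z - 6 * (N * N) - 3 * N)) =
       u * v * w * (2 * n%:Z - 12 * (N * N) - 6 * N) by ring.
  by rewrite dist !pull h2; ring.
rewrite 3?fsumD ?{}E1 ?{}E2 ?{}E3; try exact: finite_a3shell.
by move: (\sum_(_ \in _) _) => S; lia.
Qed.

(* When [3 | x4], the A_2-component of [x = 4 b + 1] can be negated inside the coset. *)
Lemma a3poly_sum_dvd n :
  \sum_(b \in a3shell n `&` [set b | (3 %| a3last b - 2)%Z]) a3poly n b = 0.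
Proof.
pose c (b : int * int * int) := ((a3last b - 2) %/ 3)%Z.
pose s (b : int * int * int) : int * int * int :=
  (- b.1.1 - 2 * c b - 2, - b.1.2 - 2 * c b - 2, - b.2 - 2 * c b - 2).
have cE b : (3 %| a3last b - 2)%Z -> a3last b = 3 * c b + 2 by rewrite /c; lia.
have sE b : (3 %| a3last b - 2)%Z -> a3last (s b) = a3last b.
  by move=> /cE; case: b => -[x y] z; rewrite /s; move: (c _) => k; rewrite /a3last/=; lia.
apply: (fsum_eq0_anti (h := s)) => b [bn b3].
- split; last by rewrite /= sE.
  move: bn; rewrite /a3shell /= sE//; have := cE _ b3; rewrite /s.
  move: (c b) => k; case: b b3 => -[x y] z _; rewrite /a3last/= => h.
  have -> : z = - 3 - x - y - 3 * k by lia.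
  by move=> <-; ring.
- have cs : c (s b) = c b by rewrite /c sE.
  rewrite {1}/s cs; case: b b3 {bn cs} => -[x y] z b3; rewrite /s /=.
  by congr (_, _, _); lia.
- rewrite /a3poly sE//; have := cE _ b3; rewrite /s; move: (c b) => k.
  by case: b b3 {bn} => -[x y] z b3 /= ->; ring.
Qed.

(* With [u = 3 a + 1] and [J = 6 j + 1], the image [b] of [(j, a)] is given by
   [4 b + 1 = (-1)^j ((4 u - J) / 3, J)]. *)
Definition a3map (p : int * (int * int)) : int * int * int :=
  let: (j, (x, y)) := p in
  if (2 %| j)%Z then let k := (j %/ 2)%Z in (x - k, y - k, -1 - x - y - k)
  else let k := ((j - 1) %/ 2)%Z in (- x + k, - y + k, 1 + x + y + k).

(** [a3map] yields [b4 = 3 k] for [j = 2 k] and [b4 = - 3 k - 2] for [j = 2 k + 1]. So [b4] modulo 3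
    recovers the parity of [j], and the residue 2, where 3 divides [4 b4 + 1], is never reached. *)
Definition a3inv (b : int * int * int) : int * (int * int) :=
  let c := (a3last b %/ 3)%Z in
  if (3 %| a3last b)%Z then (2 * c, (b.1.1 + c, b.1.2 + c))
  else (- (2 * c + 1), (- b.1.1 - c - 1, - b.1.2 - c - 1)).

(** [a3map] is a bijection onto the points of the shell with [4 b4 + 1] prime to 3. The sum over the
    other points vanishes by [a3poly_sum_dvd], and the sum over the whole shell by [a3poly_sum]. *)
Lemma a2theta_bracket_sum n :
  \sum_(p \in [set p | pentagonal p.1 + a2form p.2 = n%:Z])
    (-1) ^+ `|p.1|%N * a2cubic p.2 * (a2form p.2 - 8 * pentagonal p.1) = 0.
Proof.
transitivity (\sum_(b \in a3shell n `&` ~` [set b | (3 %| a3last b - 2)%Z]) a3poly n b).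
  apply: (fsum_can (h := a3map) (g := a3inv)).
  - move=> [j [x y]] /=; have := pentagonalE j; rewrite /a2form/= => hp h.
    case: ifPn => j2; split; rewrite /a3shell /a3last /=.
    + have : j = 2 * (j %/ 2)%Z by lia.
      move: (j %/ 2)%Z => k jk; subst j; lia.
    + lia.
    + have : j = 2 * ((j - 1) %/ 2)%Z + 1 by lia.
      move: ((j - 1) %/ 2)%Z => k jk; subst j; lia.
    + lia.
  - move=> -[[x y] z] [] bn b3; rewrite /a3inv.
    move: b3 bn; rewrite /a3shell /=; set t := a3last _.
    have : z = -1 - x - y - t by rewrite /t /a3last/=; lia.
    move: t => t -> b3; case: ifPn => t3 /=; rewrite /a2form/=.
    + have : t = 3 * (t %/ 3)%Z by lia.
      move: (t %/ 3)%Z => c tc; subst t; have := pentagonalE (2 * c); lia.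
    + have : t = 3 * (t %/ 3)%Z + 1 by lia.
      move: (t %/ 3)%Z => c tc; subst t; have := pentagonalE (- (2 * c + 1)); lia.
  - move=> [j [x y]] /= _; case: ifPn => j2; rewrite /a3inv /a3last /=.
    + by rewrite ifT; [congr (_, (_, _)); lia|lia].
    + by rewrite ifF; [congr (_, (_, _)); lia|lia].
  - move=> -[[x y] z] [] bn b3; rewrite /a3inv.
    move: b3 bn; rewrite /a3shell /=; set t := a3last _.
    have : z = -1 - x - y - t by rewrite /t /a3last/=; lia.
    move: t => t -> b3 _; case: ifPn => t3 /=.
    + by rewrite ifT; [congr (_, _, _); lia|lia].
    + by rewrite ifF; [congr (_, _, _); lia|lia].
  - move=> [j [x y]] /=; have := pentagonalE j.
    rewrite /a2form/a2cubic/a3poly/a3last/= => hp hn.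
    have {}hn : n%:Z = pentagonal j + (x * x + x * y + y * y + x + y) by [].
    rewrite hn; move: (pentagonal j) hp => p hp.
    (* For odd [j] the three linear factors change sign, which accounts for [(-1)^j]. *)
    case: ifPn => j2 /=.
    + have : j = 2 * (j %/ 2)%Z by lia.
      have -> : (-1) ^+ `|j|%N = 1 :> int by rewrite -signr_odd (_ : odd _ = false)//; lia.
      move: (j %/ 2)%Z => k jk; subst j.
      have -> : p = k * (6 * k + 1) by lia.
      by ring.
    + have : j = 2 * ((j - 1) %/ 2)%Z + 1 by lia.
      have -> : (-1) ^+ `|j|%N = -1 :> int by rewrite -signr_odd (_ : odd _ = true)//; lia.
      move: ((j - 1) %/ 2)%Z => k jk; subst j.
      have -> : p = (2 * k + 1) * (3 * k + 2) by lia.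
      by ring.
have := a3poly_sum n.
rewrite (fsbigID [set b | (3 %| a3last b - 2)%Z]) /=; last exact: finite_a3shell.
by rewrite a3poly_sum_dvd add0r.
Qed.

(** Coefficientwise form of [f H' = 8 f' H], with [f] the pentagonal series and [H] the generating
    series of [a2theta]. *)
Lemma a2theta_rec n :
  \sum_(k < n.+1) pentagonal_coef k * a2theta (n - k)%N *
     ((n - k)%N%:Z - 8 * k%:Z) = 0.
Proof.
rewrite -[RHS](a2theta_bracket_sum n).
rewrite -(fsum_conv (fun j z => (-1) ^+ `|j|%N * a2cubic z * (a2form z - 8 * pentagonal j))
  _ pentagonal_ge0 a2form_ge0 finite_pentagonal finite_a2form).
apply: eq_bigr => k _; rewrite /pentagonal_coef -mulrA mulr_fsuml.
apply: eq_fsbigr => j /set_mem /= jk; rewrite /a2theta mulrA mulr_fsumr mulr_fsuml.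
by apply: eq_fsbigr => z /set_mem /= zk; rewrite jk zk.
Qed.

(** Both sides satisfy the recursion of [eighth_power_rec_unique], so they are proportional; the
    constant terms give the ratio. *)
Lemma a2theta_euler N n : (n <= N)%N -> a2theta n = - 6 * (euler_poly N ^+ 8)`_n.
Proof.
have e0 : pentagonal_coef 0 = 1.
  by rewrite -(@euler_poly_pentagonal 0)// /euler_poly big_geq// coef1.
have a0 : a2theta 0 = - 6.
  (* The coset has three minimal vectors, each of weight -2. *)
  transitivity (\sum_(z <- [:: (0, 0); (-1, 0); (0, -1) : int * int]) a2cubic z).
    rewrite fsbig_seq//; apply: eq_fsbigl; apply/seteqP; split=> -[x y] /=.
      rewrite !inE !xpair_eqE /a2form /= => h.
      have := sqr_ge0 (2 * x + y + 1); have := sqr_ge0 (2 * y + x + 1).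
      rewrite !expr2 => hy hx.
      have [h1 h2] : 3 * x * x + 2 * x <= 1 /\ 3 * y * y + 2 * y <= 1 by split; lia.
      have {h1}hx1 : -1 <= x <= 0 by clear -h1; nia.
      have {h2}hy1 : -1 <= y <= 0 by clear -h2; nia.
      have [xE|xE] : x = 0 \/ x = -1 by lia.
        by have [yE|yE] : y = 0 \/ y = -1 by [lia]; subst.
      by have [yE|yE] : y = 0 \/ y = -1 by [lia]; subst.
    by rewrite !inE => /or3P[] /eqP[-> ->].
  by rewrite !big_cons big_nil.
have b0 : (euler_poly N ^+ 8)`_0 = 1.
  by rewrite -horner_coef0 horner_exp horner_coef0 euler_poly_pentagonal// e0.
have Hb n' : (n' <= N)%N -> \sum_(k < n'.+1) pentagonal_coef k *
    (euler_poly N ^+ 8)`_(n' - k)%N * ((n' - k)%N%:Z - 8 * k%:Z) = 0.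
  move=> n'N; rewrite -[RHS](exp8_rec (euler_poly N) n'); apply: eq_bigr => k _.
  by rewrite euler_poly_pentagonal//; have := ltn_ord k; lia.
move=> nN.
have := eighth_power_rec_unique e0 (fun n' _ => a2theta_rec n') Hb nN.
by rewrite b0 a0; lia.
Qed.

(** * The weighted theta series of D_4 *)

Definition d4shell (n : nat) : set (int * int * int * int) :=
  [set x | (2 %| x.1.1.1 + x.1.1.2 + x.1.2 + x.2)%Z /\
    x.1.1.1 * x.1.1.1 + x.1.1.2 * x.1.1.2 + x.1.2 * x.1.2 + x.2 * x.2 = n%:Z].

Lemma finite_d4shell n : finite_set (d4shell n).
Proof.
pose B := finite_int_ball n.
apply: sub_finite_set (finite_setX (finite_setX (finite_setX B B) B) B).
move=> -[[[x y] z] t]; rewrite /d4shell/= => -[_ h].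
by split; [split; [split|]|] => /=; nia.
Qed.

(* The harmonic polynomial of degree 6 invariant under signed permutations. *)
Definition b4sextic (x : int * int * int * int) : int :=
  let: (a, b, c, d) := x in
  a ^+ 6 + b ^+ 6 + c ^+ 6 + d ^+ 6
  - 5 * (a ^+ 4 * (b ^+ 2 + c ^+ 2 + d ^+ 2) + b ^+ 4 * (a ^+ 2 + c ^+ 2 + d ^+ 2)
       + c ^+ 4 * (a ^+ 2 + b ^+ 2 + d ^+ 2) + d ^+ 4 * (a ^+ 2 + b ^+ 2 + c ^+ 2))
  + 30 * (a ^+ 2 * b ^+ 2 * c ^+ 2 + a ^+ 2 * b ^+ 2 * d ^+ 2
        + a ^+ 2 * c ^+ 2 * d ^+ 2 + b ^+ 2 * c ^+ 2 * d ^+ 2).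

(* Product of a cubic harmonic polynomial on the plane of a sublattice [A_2] of
   [D_4] and of one on the orthogonal plane. *)
Definition a2a2sextic (x : int * int * int * int) : int :=
  let: (a, b, c, d) := x in let s := a + b + c in
  (3 * a - s) * (3 * b - s) * (3 * c - s) * (s * (s * s - 9 * (d * d))).

Lemma d4shell_reindex n (h : int * int * int * int -> int * int * int * int)
    (V : zmodType) (F : _ -> V) :
  (forall x, d4shell n x -> d4shell n (h x)) -> involutive h ->
  \sum_(x \in d4shell n) F (h x) = \sum_(x \in d4shell n) F x.
Proof. by move=> hD hK; apply: (fsum_can (h := h) (g := h)). Qed.

(** [a2a2sextic] is even in [d], symmetric in [a], [b], [c] and of even degree, so two sign changes
    and the exchanges with [d] suffice to average it: the 16 images add up to [24 * b4sextic]. *)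
Lemma a2a2sextic_sum n :
  2 * \sum_(x \in d4shell n) a2a2sextic x = 3 * \sum_(x \in d4shell n) b4sextic x.
Proof.
pose flip2 (x : int * int * int * int) := let: (a, b, c, d) := x in (a, - b, c, d).
pose flip3 (x : int * int * int * int) := let: (a, b, c, d) := x in (a, b, - c, d).
pose swap1 (x : int * int * int * int) := let: (a, b, c, d) := x in (d, b, c, a).
pose swap2 (x : int * int * int * int) := let: (a, b, c, d) := x in (a, d, c, b).
pose swap3 (x : int * int * int * int) := let: (a, b, c, d) := x in (a, b, d, c).
have fin := finite_d4shell n.
have f2 F : \sum_(x \in d4shell n) F (flip2 x) = \sum_(x \in d4shell n) F x :> int.
  apply: d4shell_reindex => -[[[a b] c] d]; rewrite /d4shell /flip2 /= ?opprK//.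
  by move=> [? ?]; split; lia.
have f3 F : \sum_(x \in d4shell n) F (flip3 x) = \sum_(x \in d4shell n) F x :> int.
  apply: d4shell_reindex => -[[[a b] c] d]; rewrite /d4shell /flip3 /= ?opprK//.
  by move=> [? ?]; split; lia.
have s1 F : \sum_(x \in d4shell n) F (swap1 x) = \sum_(x \in d4shell n) F x :> int.
  apply: d4shell_reindex => -[[[a b] c] d]; rewrite /d4shell /swap1 //=.
  by move=> [? ?]; split; lia.
have s2 F : \sum_(x \in d4shell n) F (swap2 x) = \sum_(x \in d4shell n) F x :> int.
  apply: d4shell_reindex => -[[[a b] c] d]; rewrite /d4shell /swap2 //=.
  by move=> [? ?]; split; lia.
have s3 F : \sum_(x \in d4shell n) F (swap3 x) = \sum_(x \in d4shell n) F x :> int.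
  apply: d4shell_reindex => -[[[a b] c] d]; rewrite /d4shell /swap3 //=.
  by move=> [? ?]; split; lia.
pose F1 x := a2a2sextic x + a2a2sextic (flip2 x).
pose F2 x := F1 x + F1 (flip3 x).
pose F3 x := F2 x + F2 (swap1 x) + F2 (swap2 x) + F2 (swap3 x).
have S1 : \sum_(x \in d4shell n) F1 x = 2 * \sum_(x \in d4shell n) a2a2sextic x.
  by rewrite /F1 fsumD// (f2 a2a2sextic) mulr2n mulrDl mul1r.
have S2 : \sum_(x \in d4shell n) F2 x = 4 * \sum_(x \in d4shell n) a2a2sextic x.
  by rewrite /F2 fsumD// (f3 F1) S1; ring.
have S3 : \sum_(x \in d4shell n) F3 x = 16 * \sum_(x \in d4shell n) a2a2sextic x.
  by rewrite /F3 3?fsumD// (s1 F2) (s2 F2) (s3 F2) S2; ring.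
have : \sum_(x \in d4shell n) F3 x = \sum_(x \in d4shell n) 24 * b4sextic x.
  apply: eq_fsbigr => -[[[a b] c] d] _.
  rewrite /F3 /F2 /F1 /flip2 /flip3 /swap1 /swap2 /swap3 /a2a2sextic /b4sextic /=.
  by ring.
rewrite S3 -(mulr_fsumr 24 _ b4sextic).
by move: (\sum_(x \in _) a2a2sextic x) (\sum_(x \in _) b4sextic x) => A B; lia.
Qed.

(** When 3 divides [a + b + c], the component of [(a, b, c)] orthogonal to [(1, 1, 1)] can be
    negated inside the lattice, and the weight is cubic in it. *)
Lemma a2a2sextic_dvd3 n :
  \sum_(x \in d4shell n `&` [set x | (3 %| x.1.1.1 + x.1.1.2 + x.1.2)%Z])
    a2a2sextic x = 0.
Proof.
pose k (x : int * int * int * int) := ((x.1.1.1 + x.1.1.2 + x.1.2) %/ 3)%Z.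
pose h (x : int * int * int * int) : int * int * int * int :=
  (2 * k x - x.1.1.1, 2 * k x - x.1.1.2, 2 * k x - x.1.2, x.2).
have kE x : (3 %| x.1.1.1 + x.1.1.2 + x.1.2)%Z ->
    x.1.2 = 3 * k x - x.1.1.1 - x.1.1.2.
  by case: x => -[[a b] c] d; rewrite /k /=; lia.
have kh x : (3 %| x.1.1.1 + x.1.1.2 + x.1.2)%Z -> k (h x) = k x.
  move=> /kE; rewrite {2}/k /h; move: (k _) => u.
  by case: x => -[[a b] c] d /=; lia.
apply: (fsum_eq0_anti (h := h)) => x [[x2 xn] x3].
- have := kE _ x3; move: x2 xn x3; rewrite /d4shell/h; move: (k _) => u.
  case: x => -[[a b] c] d /= x2 xn x3 cE; split; [split|].
  + by lia.
  + by rewrite -xn cE; ring.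
  + by lia.
- have := kh _ x3; rewrite {2}/h => ->; rewrite /h /=.
  by case: x {x2 xn x3} => -[[a b] c] d /=; congr (_, _, _, _); lia.
- have := kE _ x3; rewrite /h; move: (k _) => u {kE kh}.
  by case: x {x2 xn x3} => -[[a b] c] d /= ->; rewrite /a2a2sextic; ring.
Qed.

(** With [u], [u'] the vectors attached to the two arguments and [s = a + b + c], the image
    satisfies [3 a - s = u1], [3 b - s = u2], [3 c - s = u3], [s = - u3'] and [3 d = u2' - u1']. *)
Definition d4map (p : (int * int) * (int * int)) : int * int * int * int :=
  let: ((x, y), (x', y')) := p in
  let c := 1 + x' + y' in (x + c, y + c, -1 - x - y + c, y' - x').

Definition d4inv (v : int * int * int * int) : (int * int) * (int * int) :=
  let: (a, b, c, d) := v in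
  let k := ((a + b + c + 1) %/ 3)%Z in let x' := ((k - 1 - d) %/ 2)%Z in
  ((a - k, b - k), (x', x' + d)).

(** From [s - 3 d = 2 u1'] and [s + 3 d = 2 u2'] the second cubic becomes [- 4 u1' u2' u3']. The
    norm of the image is twice [a2form p.1 + 2 * a2form p.2 + 1]. *)
Lemma a2a2sextic_class m :
  \sum_(x \in d4shell (2 * m.+1) `&` [set x | (3 %| x.1.1.1 + x.1.1.2 + x.1.2 + 1)%Z])
    a2a2sextic x =
  \sum_(p \in [set p | a2form p.1 + 2 * a2form p.2 = m%:Z])
    - 4 * (a2cubic p.1 * a2cubic p.2).
Proof.
symmetry; apply: (fsum_can (h := d4map) (g := d4inv)).
- move=> -[[x y] [x' y']]; rewrite /a2form /d4shell /= => h; split; [split|] => /=.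
  + by lia.
  + by have -> : (2 * m.+1)%N%:Z = 2 * m%:Z + 2 by [lia]; rewrite -h; ring.
  + by lia.
- move=> -[[[a b] c] d] [[/= p2 pn] p3]; rewrite /a2form /=.
  set k := ((a + b + c + 1) %/ 3)%Z; set x' := ((k - 1 - d) %/ 2)%Z.
  have cE : c = 3 * k - 1 - a - b by rewrite /k; lia.
  (* [k - 1 - d] is even because the coordinate sum [3 k - 1 + d] is. *)
  have dE : k = 2 * x' + 1 + d by rewrite /x'; lia.
  move: k x' cE dE => k x' cE dE.
  have {}pn : a * a + b * b + c * c + d * d = 2 * m%:Z + 2 by lia.
  by move: pn; rewrite cE dE; lia.
- move=> -[[x y] [x' y']] _ /=.
  have -> : (x + (1 + x' + y') + (y + (1 + x' + y')) + (-1 - x - y + (1 + x' + y'))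
     + 1) %/ 3 = 1 + x' + y' :> int by lia.
  by congr (_, _, (_, _)); lia.
- move=> -[[[a b] c] d] [[/= p2 pn] p3].
  by congr (_, _, _, _); lia.
- by move=> -[[x y] [x' y']] _; rewrite /d4map /a2a2sextic /a2cubic /=; ring.
Qed.

(** Split by [a + b + c] modulo 3: the class 0 cancels, and negation exchanges the two other classes
    while preserving the weight, hence twice the factor -4. *)
Lemma a2a2sextic_sum_class m :
  \sum_(x \in d4shell (2 * m.+1)) a2a2sextic x =
  - 8 * \sum_(p \in [set p | a2form p.1 + 2 * a2form p.2 = m%:Z])
          (a2cubic p.1 * a2cubic p.2).
Proof.
have fin := finite_d4shell (2 * m.+1).
pose T0 := [set x : int * int * int * int | (3 %| x.1.1.1 + x.1.1.2 + x.1.2)%Z].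
pose T1 := [set x : int * int * int * int | (3 %| x.1.1.1 + x.1.1.2 + x.1.2 + 1)%Z].
rewrite (fsbigID T0) /=; last exact: fin.
rewrite a2a2sextic_dvd3 add0r (fsbigID T1) /=; last first.
  by apply: sub_finite_set fin => x [].
have -> : d4shell (2 * m.+1) `&` ~` T0 `&` T1 = d4shell (2 * m.+1) `&` T1.
  apply/seteqP; split=> x; first by move=> [[? _] ?].
  move=> [xD x1]; split => //; split=> //; move: x1 {xD}.
  by case: x => -[[a b] c] d; rewrite /T0 /T1 /=; lia.
have -> : \sum_(x \in d4shell (2 * m.+1) `&` ~` T0 `&` ~` T1) a2a2sextic x =
          \sum_(x \in d4shell (2 * m.+1) `&` T1) a2a2sextic x.
  pose h (x : int * int * int * int) : int * int * int * int :=
    (- x.1.1.1, - x.1.1.2, - x.1.2, - x.2).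
  apply: (fsum_can (h := h) (g := h)) => -[[[a b] c] d];
    rewrite /h /d4shell /T0 /T1 /= ?opprK//; last by move=> _; ring.
  - by move=> [[[? ?] ?] ?]; split; [split|]; lia.
  - by move=> [[? ?] ?]; split; [split; [split|]|]; lia.
rewrite a2a2sextic_class -(mulr_fsumr _ _ (fun p => a2cubic p.1 * a2cubic p.2)); ring.
Qed.

(** The theta series factors as [H(q) H(q^2)] with [H = - 6 f^8], so the constant is
    [(2 / 3) (- 8) (- 6)^2]. The factor ['X] comes from the shift by 1 in the norm of the coset. *)
Lemma b4sextic_sum N m : (m <= N)%N ->
  \sum_(x \in d4shell (2 * m.+1)) b4sextic x =
  - 192 * ('X * (euler_poly N ^+ 8 * (euler_poly N ^+ 8 \Po 'X^2)))`_m.+1.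
Proof.
move=> mN; have := a2a2sextic_sum (2 * m.+1); rewrite a2a2sextic_sum_class.
have psi0 z : 0 <= 2 * a2form z by have := a2form_ge0 z; lia.
have fin2 (k : nat) : finite_set [set z | 2 * a2form z <= k%:Z].
  by apply: sub_finite_set (finite_a2form k) => z /=; have := a2form_ge0 z; lia.
rewrite -(fsum_conv (fun p q => a2cubic p * a2cubic q) _ a2form_ge0 psi0 finite_a2form fin2).
rewrite coefXM /= coefM => H.
suff E : \sum_(k < m.+1) \sum_(x \in [set x | a2form x = k%:Z])
     \sum_(y \in [set y | 2 * a2form y = (m - k)%N%:Z]) a2cubic x * a2cubic y =
   36 * \sum_(k < m.+1) (euler_poly N ^+ 8)`_k * (euler_poly N ^+ 8 \Po 'X^2)`_(m - k).
  move: H; rewrite {}E.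
  by move: (\sum_(x \in _) b4sextic x) (\sum_(k < _) _) => B t; lia.
rewrite mulr_sumr; apply: eq_bigr => -[k /= km] _.
rewrite coef_comp_poly_Xn//.
have -> : \sum_(x \in [set x | a2form x = k%:Z])
   \sum_(y \in [set y | 2 * a2form y = (m - k)%N%:Z]) a2cubic x * a2cubic y =
   a2theta k * \sum_(y \in [set y | 2 * a2form y = (m - k)%N%:Z]) a2cubic y.
  rewrite /a2theta mulr_fsuml; apply: eq_fsbigr => x _.
  by rewrite mulr_fsumr.
rewrite (@a2theta_euler N k); last by lia.
have -> : \sum_(y \in [set y | 2 * a2form y = (m - k)%N%:Z]) a2cubic y =
   if (2 %| m - k)%N then a2theta ((m - k) %/ 2) else 0.
  case: ifPn => h; last by apply: fsbig1 => z /=; move: h; lia.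
  by apply: eq_fsbigl; apply/seteqP; split=> z /=; lia.
case: ifPn => h; last by rewrite !mulr0.
by rewrite (@a2theta_euler N); [ring|lia].
Qed.

(** * Harmonic sextics summed over a shell *)

Definition row4 (V : nmodType) (v : V * V * V * V) : 'rV[V]_4 :=
  \row_i nth 0 [:: v.1.1.1; v.1.1.2; v.1.2; v.2] i.

Lemma row4_tuple (V : nmodType) (x : 'rV[V]_4) :
  row4 (x ord0 0, x ord0 1, x ord0 2, x ord0 3) = x.
Proof.
apply/rowP => i; rewrite mxE /=.
by case: i => -[|[|[|[|]]]] //= i4; congr (x _ _); apply: val_inj.
Qed.

Definition d4point (R : realType) (c : R) (v : int * int * int * int) : 'rV[R]_4 :=
  c *: map_mx (fun a : int => a%:~R) (row4 v).

Lemma d4pointE (R : realType) (c : R) v :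
  (d4point c v ord0 0 = c * v.1.1.1%:~R) * (d4point c v ord0 1 = c * v.1.1.2%:~R) *
  ((d4point c v ord0 2 = c * v.1.2%:~R) * (d4point c v ord0 3 = c * v.2%:~R)).
Proof. by rewrite /d4point !mxE. Qed.

Lemma D4design_fsum (R : realType) (m : nat) (F : 'rV[R]_4 -> R) : (0 < m)%N ->
  \sum_(x \in D4design R m) F x =
  \sum_(v \in d4shell (2 * m)) F (d4point (Num.sqrt (2 * m)%N%:R)^-1 v).
Proof.
move=> m0; set c := (Num.sqrt _)^-1.
have c0 : c != 0 by rewrite invr_eq0 sqrtr_eq0 -ltNge ltr0n muln_gt0.
rewrite /D4design -/c fsbig_image; last first.
  move=> x y _ _ /(scalerI c0)/rowP xy; apply/rowP => i.
  by have := xy i; rewrite !mxE => /intr_inj.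
symmetry; apply: (fsum_can (h := @row4 int)
  (g := fun x : 'rV[int]_4 => (x ord0 0, x ord0 1, x ord0 2, x ord0 3))) => //.
- move=> -[[[a b] c'] d]; rewrite /d4shell /D4shell /D4 /= => -[h1 h2].
  by rewrite !HarmonicSextics.big_ord4 !mxE /= !expr2.
- move=> x; rewrite /d4shell /D4shell /D4 /= !HarmonicSextics.big_ord4 /= !expr2.
  by [].
- by move=> -[[[a b] c'] d] _; rewrite !mxE.
- by move=> x _; rewrite row4_tuple.
Qed.

Section Strength.
Variables (R : realType) (n : nat) (c : R).
Let X := d4shell n.
Let s : seq 'rV[R]_4 := [seq d4point c v | v <- finmap.enum_fset (fset_set X)].

Let sumsE (F : 'rV[R]_4 -> R) :
  \sum_(x <- s) F x = \sum_(v \in X) F (d4point c v).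
Proof. by rewrite big_map fsbig_finite//; exact: finite_d4shell. Qed.

Let mon (p q r t : nat) (v : int * int * int * int) : R :=
  (c * v.1.1.1%:~R) ^+ p * (c * v.1.1.2%:~R) ^+ q * (c * v.1.2%:~R) ^+ r
  * (c * v.2%:~R) ^+ t.

Let momentE p q r t :
  HarmonicSextics.moment s p q r t = \sum_(v \in X) mon p q r t v.
Proof.
by rewrite /HarmonicSextics.moment sumsE; apply: eq_fsbigr => v _; rewrite !d4pointE.
Qed.

Let swap01 (v : int * int * int * int) : int * int * int * int :=
  (v.1.1.2, v.1.1.1, v.1.2, v.2).
Let swap12 (v : int * int * int * int) : int * int * int * int :=
  (v.1.1.1, v.1.2, v.1.1.2, v.2).
Let swap23 (v : int * int * int * int) : int * int * int * int :=
  (v.1.1.1, v.1.1.2, v.2, v.1.2).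
Let swap02 (v : int * int * int * int) : int * int * int * int :=
  (v.1.2, v.1.1.2, v.1.1.1, v.2).
Let swap03 (v : int * int * int * int) : int * int * int * int :=
  (v.2, v.1.1.2, v.1.2, v.1.1.1).

Let reindex01 (F : _ -> R) : \sum_(v \in X) F (swap01 v) = \sum_(v \in X) F v.
Proof.
apply: d4shell_reindex => -[[[x y] z] t] //=.
by rewrite /d4shell/= => -[? ?]; split; lia.
Qed.

Let reindex12 (F : _ -> R) : \sum_(v \in X) F (swap12 v) = \sum_(v \in X) F v.
Proof.
apply: d4shell_reindex => -[[[x y] z] t] //=.
by rewrite /d4shell/= => -[? ?]; split; lia.
Qed.

Let reindex23 (F : _ -> R) : \sum_(v \in X) F (swap23 v) = \sum_(v \in X) F v.
Proof.
apply: d4shell_reindex => -[[[x y] z] t] //=.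
by rewrite /d4shell/= => -[? ?]; split; lia.
Qed.

Let reindex02 (F : _ -> R) : \sum_(v \in X) F (swap02 v) = \sum_(v \in X) F v.
Proof.
apply: d4shell_reindex => -[[[x y] z] t] //=.
by rewrite /d4shell/= => -[? ?]; split; lia.
Qed.

Let reindex03 (F : _ -> R) : \sum_(v \in X) F (swap03 v) = \sum_(v \in X) F v.
Proof.
apply: d4shell_reindex => -[[[x y] z] t] //=.
by rewrite /d4shell/= => -[? ?]; split; lia.
Qed.

Let moment01 p q r t :
  HarmonicSextics.moment s p q r t = HarmonicSextics.moment s q p r t.
Proof.
rewrite !momentE -(reindex01 (mon q p r t)); apply: eq_fsbigr => v _.
by rewrite /mon /=; ring.
Qed.

Let moment12 p q r t :
  HarmonicSextics.moment s p q r t = HarmonicSextics.moment s p r q t.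
Proof.
rewrite !momentE -(reindex12 (mon p r q t)); apply: eq_fsbigr => v _.
by rewrite /mon /=; ring.
Qed.

Let moment23 p q r t :
  HarmonicSextics.moment s p q r t = HarmonicSextics.moment s p q t r.
Proof.
rewrite !momentE -(reindex23 (mon p q t r)); apply: eq_fsbigr => v _.
by rewrite /mon /=; ring.
Qed.

Let moment_odd0 p q r t : odd p -> HarmonicSextics.moment s p q r t = 0.
Proof.
move=> p1; rewrite momentE.
pose flip (v : int * int * int * int) : int * int * int * int :=
  (- v.1.1.1, v.1.1.2, v.1.2, v.2).
have E : \sum_(v \in X) mon p q r t (flip v) = \sum_(v \in X) mon p q r t v.
  apply: d4shell_reindex => -[[[x y] z] u]; rewrite /flip /= ?opprK//.
  by rewrite /d4shell/= => -[? ?]; split; lia.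
have : \sum_(v \in X) mon p q r t (flip v) = - \sum_(v \in X) mon p q r t v.
  rewrite -[RHS]mulN1r mulr_fsumr; apply: eq_fsbigr => v _.
  by rewrite /mon /flip /= mulrNz mulrN exprNn -signr_odd p1 expr1 !mulN1r !mulNr.
rewrite E => /eqP; rewrite -addr_eq0 -mulr2n mulrn_eq0 /= => /eqP; exact.
Qed.

Let moment_odd p q r t : [|| odd p, odd q, odd r | odd t] ->
  HarmonicSextics.moment s p q r t = 0.
Proof.
case/or4P; first exact: moment_odd0.
- by rewrite moment01; exact: moment_odd0.
- by rewrite moment12 moment01; exact: moment_odd0.
- by rewrite moment23 moment12 moment01; exact: moment_odd0.
Qed.

Let b4sextic_scaled : \sum_(x <- s) Harmonic.evalp (HarmonicSextics.b4sextic_mpoly R) x =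
  c ^+ 6 * (\sum_(v \in X) b4sextic v)%:~R.
Proof.
rewrite sumsE fsbig_finite; last exact: finite_d4shell.
rewrite [in RHS]fsbig_finite; last exact: finite_d4shell.
rewrite raddf_sum /= mulr_sumr; apply: eq_bigr => v _.
rewrite HarmonicSextics.b4sextic_mpoly_eval !d4pointE; case: v => -[[x y] z] t /=.
by rewrite !(intrD, intrM, rmorphN, rmorphXn, rmorphB) /=; ring.
Qed.

Let b4sextic_moments : 4 * (HarmonicSextics.moment s 6 0 0 0
    - 15 * HarmonicSextics.moment s 4 2 0 0 + 30 * HarmonicSextics.moment s 2 2 2 0) =
  c ^+ 6 * (\sum_(v \in X) b4sextic v)%:~R.
Proof.
have fin := finite_d4shell n.
(* [H] is the share of the first coordinate in the invariant sextic. A product of three squares is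
   shared by three coordinates, whence 10 in place of 30. *)
pose H v := mon 6 0 0 0 v - 5 * (mon 4 2 0 0 v + mon 4 0 2 0 v + mon 4 0 0 2 v)
   + 10 * (mon 2 2 2 0 v + mon 2 2 0 2 v + mon 2 0 2 2 v).
have HE : \sum_(v \in X) H v = HarmonicSextics.moment s 6 0 0 0
    - 15 * HarmonicSextics.moment s 4 2 0 0 + 30 * HarmonicSextics.moment s 2 2 2 0.
  transitivity (HarmonicSextics.moment s 6 0 0 0
    - 5 * (HarmonicSextics.moment s 4 2 0 0 + HarmonicSextics.moment s 4 0 2 0 +
           HarmonicSextics.moment s 4 0 0 2)
    + 10 * (HarmonicSextics.moment s 2 2 2 0 + HarmonicSextics.moment s 2 2 0 2
            + HarmonicSextics.moment s 2 0 2 2)).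
    rewrite !momentE !fsbig_finite//= -!big_split/= !mulr_sumr -sumrB -big_split/=.
    by [].
  rewrite (moment23 4 0 0 2) (moment12 4 0 2 0).
  by rewrite (moment12 2 0 2 2) (moment23 2 2 0 2); ring.
rewrite -{}HE -b4sextic_scaled sumsE.
have sum4 (K : _ -> R) :
    \sum_(v \in X) (K v + K (swap01 v) + K (swap02 v) + K (swap03 v)) =
    4 * \sum_(v \in X) K v.
  by rewrite 3?fsumD// (reindex01 K) (reindex02 K) (reindex03 K); ring.
rewrite -sum4; apply: eq_fsbigr => v _; rewrite HarmonicSextics.b4sextic_mpoly_eval !d4pointE.
by rewrite /H /mon /=; ring.
Qed.

(** The invariant sextic is itself harmonic; conversely, the vanishing of its sum is the moment
    relation that makes all sextic sums factor through the Laplacian. *)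
Lemma harmonic_sextics_vanish : c != 0 ->
  (forall P, Harmonic.Harm 6 P -> \sum_(v \in X) Harmonic.evalp P (d4point c v) = 0)
  <-> \sum_(v \in X) b4sextic v = 0.
Proof.
move=> c0; split=> [h|h P hP].
  have := h _ (HarmonicSextics.b4sextic_mpoly_harmonic R).
  rewrite -sumsE b4sextic_scaled => /eqP.
  by rewrite mulf_eq0 expf_eq0 /= (negbTE c0) intr_eq0 => /eqP.
rewrite -sumsE; apply: HarmonicSextics.harmonic_sextic_sum hP => //.
have := b4sextic_moments; rewrite h mulr0 => /eqP.
by rewrite mulf_eq0 pnatr_eq0 /= => /eqP.
Qed.

End Strength.

(** * The q-expansion of the eta product *)

Lemma horner_norm_bound (R : realType) (p : {poly R}) (q : R) : 0 <= q <= 1 ->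
  `|p.[q]| <= \sum_(i < size p) `|p`_i|.
Proof.
move=> /andP[q0 q1]; rewrite horner_coef; apply: le_trans (ler_norm_sum _ _ _) _.
apply: ler_sum => i _; rewrite normrM ler_piMr// ger0_norm ?exprn_ge0//.
exact: exprn_ile1.
Qed.

(** Letting [q] tend to 0 kills the constant term; dividing by the variable then lowers the order by
    one. *)
Lemma poly_small_coef0 (R : realType) (p : {poly R}) (K r : R) (N : nat) :
  0 < r -> (forall q, 0 < q -> q <= r -> `|p.[q]| <= K * q ^+ N) ->
  forall i, (i < N)%N -> p`_i = 0.
Proof.
move=> r0; elim: N p => [//|N IH] p; elim/poly_ind: p => [_ i _|p c _ hp].
  by rewrite coef0.
have hpE q : (p * 'X + c%:P).[q] = p.[q] * q + c by rewrite !hornerE.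
have c0 : c = 0.
  apply/eqP/negPn/negP => c0; set B := \sum_(i < size p) `|p`_i|.
  (* The hypothesis gives [|c| <= (B + |K|) q] for small [q], which fails once
     [q (B + |K| + 1) <= |c| / 2]. *)
  have B0 : 0 <= B by apply: sumr_ge0.
  have D0 : 0 < B + `|K| + 1 by rewrite ltr_wpDl// addr_ge0.
  pose q := Num.min (Num.min r 1) (`|c| / 2 / (B + `|K| + 1)).
  have q0 : 0 < q.
    by rewrite !lt_min r0 ltr01 divr_gt0// divr_gt0// normr_gt0.
  have qr : q <= r by rewrite !ge_min lexx.
  have q1 : q <= 1 by rewrite !ge_min lexx orbT.
  have qc : q * (B + `|K| + 1) <= `|c| / 2.
    by rewrite -ler_pdivlMr// ge_min lexx orbT.
  have := hp _ q0 qr; rewrite hpE => h.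
  have hB : `|p.[q]| * q <= B * q.
    by rewrite ler_wpM2r ?(ltW q0)// horner_norm_bound// (ltW q0).
  have hK : K * q ^+ N.+1 <= `|K| * q.
    apply: le_trans (_ : `|K| * q ^+ N.+1 <= _).
      by rewrite ler_wpM2r ?exprn_ge0 ?(ltW q0)// ler_norm.
    rewrite ler_wpM2l// exprS ler_piMr ?(ltW q0)//.
    by rewrite exprn_ile1// (ltW q0).
  have hc : `|c| <= `|p.[q] * q + c| + `|p.[q]| * q.
    have -> : `|p.[q]| * q = `|p.[q] * q| by rewrite normrM (ger0_norm (ltW q0)).
    rewrite -{1}[c](addrK (p.[q] * q)) [c + _]addrC.
    exact: ler_normB.
  have cgt : 0 < `|c| by rewrite normr_gt0.
  by nra.
case=> [_|i iN]; first by rewrite c0 addr0 coefMX.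
rewrite c0 addr0 coefMX /=; apply: IH => // q q0 qr.
have := hp _ q0 qr; rewrite hpE c0 addr0 normrM (ger0_norm (ltW q0)) exprSr mulrA.
by rewrite ler_pM2r.
Qed.

Definition euler_prod (R : realType) (q : R) (N : nat) : R :=
  \prod_(1 <= i < N.+1) (1 - q ^+ i).

Lemma euler_prod_horner (R : realType) (q : R) N :
  (map_poly intr (euler_poly N)).[q] = euler_prod q N.
Proof.
rewrite /euler_poly /euler_prod rmorph_prod horner_prod; apply: eq_bigr => i _.
by rewrite rmorphB rmorph1 /= map_polyXn !hornerE.
Qed.

Section EulerProduct.
Variables (R : realType) (q : R).
Hypotheses (q0 : 0 <= q) (q2 : q <= 1 / 2).

Let q1 : q <= 1. Proof. move: q2; lra. Qed.

Let pow_le (n : nat) : q ^+ n.+1 <= 1 / 2.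
Proof.
rewrite exprS; have : q ^+ n <= 1 by exact: exprn_ile1.
have : 0 <= q ^+ n by exact: exprn_ge0.
move: q0 q2; nra.
Qed.

Let euler_prodS N : euler_prod q N.+1 = euler_prod q N * (1 - q ^+ N.+1).
Proof. by rewrite /euler_prod big_nat_recr. Qed.

Lemma euler_prod_ge0 N : 0 <= euler_prod q N.
Proof.
elim: N => [|N IH]; first by rewrite /euler_prod big_geq.
by rewrite euler_prodS mulr_ge0//; have := pow_le N; lra.
Qed.

Lemma euler_prod_le N n : (N <= n)%N -> euler_prod q n <= euler_prod q N.
Proof.
elim: n => [|n IH]; first by rewrite leqn0 => /eqP ->.
rewrite leq_eqVlt => /predU1P[-> //|/IH]; apply: le_trans.
rewrite euler_prodS ler_piMr ?euler_prod_ge0//.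
by rewrite lerBlDr lerDl exprn_ge0.
Qed.

(** The extra term [2 * q ^+ n.+1] in the strengthened bound makes the induction close; this uses
    [2 q <= 1]. *)
Lemma euler_prod_ge N n : (N <= n)%N ->
  euler_prod q N * (1 - 2 * q ^+ N.+1) <= euler_prod q n.
Proof.
move=> Nn; apply: le_trans
  (_ : euler_prod q N * (1 - 2 * q ^+ N.+1 + 2 * q ^+ n.+1) <= _).
  by rewrite ler_wpM2l ?euler_prod_ge0// lerDl mulr_ge0 ?exprn_ge0.
elim: n Nn => [|n IH].
  by rewrite leqn0 => /eqP ->; rewrite subrK mulr1.
rewrite leq_eqVlt => /predU1P[<-|]; first by rewrite subrK mulr1.
rewrite ltnS => Nn; rewrite euler_prodS.
apply: le_trans (_ : euler_prod q N * (1 - 2 * q ^+ N.+1 + 2 * q ^+ n.+1) *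
   (1 - q ^+ n.+1) <= _); last first.
  by rewrite ler_wpM2r ?IH//; have := pow_le n; lra.
rewrite -mulrA ler_wpM2l ?euler_prod_ge0//.
have := exprn_ge0 n.+1 q0; have := exprn_ge0 N.+1 q0.
have : q ^+ n.+1 <= q ^+ N.+1 by rewrite ler_wiXn2l.
rewrite (exprS _ n.+1); move: (q ^+ n.+1) (q ^+ N.+1) => x y; move: q0 q2; nra.
Qed.

Lemma euler_prod_cvg : cvgn (euler_prod q).
Proof.
apply: nonincreasing_is_cvgn; first by move=> N n; exact: euler_prod_le.
by exists 0 => _ [N _ <-]; exact: euler_prod_ge0.
Qed.

Lemma euler_prod_lim_le N : limn (euler_prod q) <= euler_prod q N.
Proof.
apply: limr_le; first exact: euler_prod_cvg.
by exists N => // n /=; exact: euler_prod_le.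
Qed.

Lemma euler_prod_lim_ge N :
  euler_prod q N * (1 - 2 * q ^+ N.+1) <= limn (euler_prod q).
Proof.
apply: limr_ge; first exact: euler_prod_cvg.
by exists N => // n /=; exact: euler_prod_ge.
Qed.

End EulerProduct.

(** * The eta function on the imaginary axis *)

Section ComplexReal.
Variable R : realType.
Local Notation C := R[i].

Lemma normc_real (x : R) : `|x%:C%C| = `|x|%:C%C :> C.
Proof. by rewrite normc_def /= expr0n addr0 sqrtr_sqr. Qed.

Lemma cvg_real_complex (u : nat -> R) (l : R) :
  ((fun n => (u n)%:C%C : C^o) @ \oo --> (l%:C%C : C^o)) <-> (u @ \oo --> l).
Proof.
split=> /pseudometric_normed_Zmodule.cvgrPdist_lt h;
    apply/pseudometric_normed_Zmodule.cvgrPdist_lt => e e0.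
  have := h e%:C%C; rewrite ltcR => /(_ e0); apply: filterS => n.
  by rewrite -rmorphB normc_real ltcR.
(* A positive complex number is real, so only real radii have to be treated. *)
case: e e0 => e e' /[dup]; rewrite {1}ltcE /= => /andP[/eqP -> e0] _.
by have := h e e0; apply: filterS => n; rewrite -rmorphB normc_real complexr0 ltcR.
Qed.

Lemma cexp_real (x : R) : cexp (x%:C%C) = (expR x)%:C%C.
Proof. by rewrite /cexp /= cos0 sin0 complexr0 mulr1. Qed.

Lemma two_pi_i_imag (y : R) : two_pi_i R * (0 +i* y)%C = (- (2 * pi * y))%:C%C.
Proof. by rewrite /two_pi_i; simpc. Qed.

Lemma eta_imag (y : R) : let L := - (2 * pi * y) in expR L <= 1 / 2 ->
  Defs.eta (0 +i* y)%C = (expR (L / 24) * limn (euler_prod (expR L)))%:C%C.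
Proof.
move=> L L2; rewrite /Defs.eta /nome two_pi_i_imag -/L cexp_real.
have -> : L%:C%C / 24 = (L / 24)%:C%C :> C.
  by rewrite rmorphM fmorphV rmorph_nat.
rewrite cexp_real rmorphM /=; congr (_ * _).
apply: (@pseudometric_normed_Zmodule.norm_cvg_lim _ (C^o)).
have := euler_prod_cvg (expR_ge0 L) L2 => /cvg_real_complex.
rewrite (_ : (fun n => _) = (fun N : nat => \prod_(1 <= n < N.+1)
   (1 - (expR L)%:C%C ^+ n) : C^o))//.
apply/funext => N; rewrite /euler_prod rmorph_prod; apply: eq_bigr => i _.
by rewrite rmorphB rmorph1 rmorphXn.
Qed.

(** Evaluation at [z = i y] with [exp(- 2 pi y) = q]: the nome of [2 z] is [q ^+ 2], and the
    prefactors have exponents [8 / 24] and [16 / 24], giving the single factor [q]. *)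
Lemma eta8_eta8_real (tau : nat -> int) : eta8_eta8_coefficients R tau ->
  forall q : R, 0 < q -> q <= 1 / 2 ->
  (fun N => \sum_(1 <= m < N.+1) (tau m)%:~R * q ^+ m) @ \oo -->
  q * (limn (euler_prod q) * limn (euler_prod (q ^+ 2))) ^+ 8.
Proof.
move=> htau q q0 q2; pose y := - ln q / (2 * pi).
have pi0 : 0 < pi :> R := pi_gt0 R.
have pi2 : 2 * pi != 0 :> R by rewrite mulf_neq0// gt_eqF.
have y0 : 0 < y.
  rewrite divr_gt0 ?mulr_gt0// oppr_gt0 ln_lt0// q0/=; lra.
have Ly : - (2 * pi * y) = ln q by rewrite /y mulrCA mulfV// mulr1 opprK.
have L2y : - (2 * pi * (2 * y)) = 2 * ln q by rewrite -Ly; ring.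
have eq1 : expR (ln q) = q by rewrite lnK// posrE.
have eq2 : expR (2 * ln q) = q ^+ 2 by rewrite mulrC expRM_natr ?eq1.
have q4 : q ^+ 2 <= 1 / 2 by rewrite expr2; nra.
have e1 : Defs.eta (0 +i* y)%C = (expR (ln q / 24) * limn (euler_prod q))%:C%C.
  by rewrite eta_imag Ly eq1.
have e2 : Defs.eta (2 * (0 +i* y)%C) =
    (expR (2 * ln q / 24) * limn (euler_prod (q ^+ 2)))%:C%C.
  have -> : 2 * (0 +i* y)%C = (0 +i* (2 * y))%C.
    by rewrite mulr_natl mulr2n; simpc; rewrite -mulr2n mulr_natl.
  by rewrite eta_imag L2y eq2.
have := htau (0 +i* y)%C y0; rewrite e1 e2 /nome two_pi_i_imag Ly cexp_real eq1.
move=> h; apply/cvg_real_complex.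
have -> : (q * (limn (euler_prod q) * limn (euler_prod (q ^+ 2))) ^+ 8)%:C%C =
    (expR (ln q / 24) * limn (euler_prod q))%:C%C ^+ 8 *
    (expR (2 * ln q / 24) * limn (euler_prod (q ^+ 2)))%:C%C ^+ 8 :> C.
  rewrite -!rmorphXn -rmorphM /=; congr (_%:C%C); rewrite !exprMn.
  have -> : forall x y, q * (x * y) =
      expR (ln q / 24) ^+ 8 * x * (expR (2 * ln q / 24) ^+ 8 * y).
    move=> u v; rewrite mulrACA; congr (_ * _).
    by rewrite -!expRM_natr -expRD -{1}eq1; congr expR; field.
  by [].
move: h; set f := (X in X @ _ --> _ -> _); set g := (X in _ -> X @ _ --> _).
have -> // : f = g.
rewrite /f /g; apply/funext => N; rewrite rmorph_sum /=; apply: eq_bigr => i _.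
by rewrite rmorphM rmorphXn rmorph_int.
Qed.

End ComplexReal.

(** * Comparison of the two expansions for small real q *)

Lemma exprB_le (R : realType) (x y : R) (n : nat) : 0 <= x -> x <= y -> y <= 1 ->
  y ^+ n - x ^+ n <= n%:R * (y - x).
Proof.
move=> x0 xy y1; elim: n => [|n IH]; first by rewrite !expr0 subrr mul0r.
have -> : y ^+ n.+1 - x ^+ n.+1 = y * (y ^+ n - x ^+ n) + x ^+ n * (y - x).
  by rewrite !exprS; ring.
have : x ^+ n <= 1 by apply: exprn_ile1 => //; exact: le_trans xy y1.
have : 0 <= x ^+ n by exact: exprn_ge0.
have : x ^+ n <= y ^+ n by apply: lerXn2r => //; rewrite nnegrE//; lra.
rewrite -natr1; move: (x ^+ n) (y ^+ n) (n%:R) IH => u v k IH; nra.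
Qed.

Section CoefficientBound.
Variables (R : realType) (t : nat -> R).
Let S (q : R) (n : nat) : R := \sum_(1 <= m < n.+1) t m * q ^+ m.

Let SS q n : S q n.+1 = S q n + t n.+1 * q ^+ n.+1.
Proof. by rewrite /S big_nat_recr. Qed.

(** Convergence at [1 / 2] bounds the terms there by some [M], so for smaller [q] the tail is
    dominated by a geometric series of ratio [2 q]. *)
Lemma power_series_tail (N : nat) (L : R -> R) :
  (forall q, 0 < q -> q <= 1 / 2 -> S q @ \oo --> L q) ->
  exists K, forall q, 0 < q -> q <= 1 / 4 -> `|L q - S q N| <= K * q ^+ N.+1.
Proof.
move=> hL; have half0 : 0 < 1 / 2 :> R by lra.
have [M [M0 hM]] : exists M, 0 <= M /\ forall m, `|t m.+1 * (1 / 2) ^+ m.+1| <= M.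
  have /cvg_seq_bounded : cvgn (S (1 / 2)) by apply: cvgP (hL _ half0 (lexx _)).
  move=> [B0 [_ hB0]]; pose B := B0 + 1.
  have hB n : `|S (1 / 2) n| <= B by apply: hB0 => //; rewrite ltrDl.
  exists (B + B); split; first by rewrite addr_ge0// (le_trans _ (hB 0%N)).
  move=> m; have -> : t m.+1 * (1 / 2) ^+ m.+1 = S (1 / 2) m.+1 - S (1 / 2) m.
    by rewrite SS addrC addKr.
  by rewrite (le_trans (ler_normB _ _))// lerD.
exists (2 * M * 2 ^+ N.+1) => q q0 q4.
(* Keeping the negative term lets the induction close, as [2 (2 q) <= 1]. *)
have hx n : (N <= n)%N ->
    `|S q n - S q N| <= 2 * M * ((2 * q) ^+ N.+1 - (2 * q) ^+ n.+1).
  elim: n => [|n IH].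
    by rewrite leqn0 => /eqP ->; rewrite !subrr mulr0 normr0.
  rewrite leq_eqVlt => /predU1P[<-|]; first by rewrite !subrr mulr0 normr0.
  rewrite ltnS => /IH{}IH; rewrite SS addrAC.
  apply: le_trans (ler_normD _ _) _.
  have : `|t n.+1 * q ^+ n.+1| <= M * (2 * q) ^+ n.+1.
    have -> : t n.+1 * q ^+ n.+1 = t n.+1 * (1 / 2) ^+ n.+1 * (2 * q) ^+ n.+1.
      by rewrite -mulrA -exprMn; congr (_ * _ ^+ _); field.
    rewrite normrM [X in _ * X]ger0_norm; last by apply: exprn_ge0; lra.
    by apply: ler_wpM2r => //; apply: exprn_ge0; lra.
  have x0 : 0 <= (2 * q) ^+ n.+1 by apply: exprn_ge0; lra.
  have {x0} : 0 <= M * (2 * q) ^+ n.+1 * (1 - 2 * (2 * q)).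
    by rewrite !mulr_ge0//; lra.
  rewrite (exprS _ n.+1); move: IH; move: (`|_|) (`|_|) => u v; lra.
have cvN : `|S q n - S q N| @[n --> \oo] --> `|L q - S q N|.
  by apply: cvg_norm; apply: cvgB; [apply: hL => //; lra|exact: cvg_cst].
rewrite -(cvg_lim _ cvN)//; apply: limr_le; first exact: (cvgP _ cvN).
exists N => // n /= /hx /le_trans; apply.
rewrite -[X in _ <= X]mulrA -exprMn ler_wpM2l ?mulr_ge0//.
by rewrite gerBl; apply: exprn_ge0; lra.
Qed.

End CoefficientBound.

(** Each truncated product is within [2 * q ^+ N.+1] of its limit and all factors lie in [[0, 1]],
    so the products differ by at most [4 * q ^+ N.+1]; the eighth power multiplies this by 8. *)
Lemma euler_prod_lim_approx (R : realType) (N : nat) (q : R) : 0 < q -> q <= 1 / 4 ->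
  `|q * (limn (euler_prod q) * limn (euler_prod (q ^+ 2))) ^+ 8 -
    q * (euler_prod q N * euler_prod (q ^+ 2) N) ^+ 8| <= 32 * q ^+ N.+1.
Proof.
move=> q0 q4; have q2 : q <= 1 / 2 by lra.
have qq0 : 0 <= q ^+ 2 by exact: sqr_ge0.
have qq : q ^+ 2 <= q by rewrite expr2; nra.
have qq2 : q ^+ 2 <= 1 / 2 by lra.
have P1 := euler_prod_le (ltW q0) q2 (leq0n N).
have P2 := euler_prod_le qq0 qq2 (leq0n N).
have Z x : euler_prod x 0 = 1 :> R by rewrite /euler_prod big_geq.
rewrite !Z in P1 P2.
have P10 := euler_prod_ge0 (ltW q0) q2 N; have P20 := euler_prod_ge0 qq0 qq2 N.
have l1 := euler_prod_lim_le (ltW q0) q2 N; have l2 := euler_prod_lim_le qq0 qq2 N.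
have g1 := euler_prod_lim_ge (ltW q0) q2 N; have g2 := euler_prod_lim_ge qq0 qq2 N.
have d2 : (q ^+ 2) ^+ N.+1 <= q ^+ N.+1.
  by apply: lerXn2r => //; rewrite nnegrE ltW.
have d0 : 0 <= q ^+ N.+1 by apply: exprn_ge0; exact: ltW.
have d4 : q ^+ N.+1 <= 1 / 4.
  rewrite exprS; have : q ^+ N <= 1 by apply: exprn_ile1; lra.
  have : 0 <= q ^+ N by apply: exprn_ge0; lra.
  by nra.
have dd0 : 0 <= (q ^+ 2) ^+ N.+1 by exact: exprn_ge0.
rewrite -mulrBr normrM (ger0_norm (ltW q0)).
move: (limn (euler_prod q)) (limn (euler_prod (q ^+ 2))) l1 l2 g1 g2 => x1 x2.
move: (euler_prod q N) (euler_prod (q ^+ 2) N) P1 P2 P10 P20 => y1 y2.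
move: ((q ^+ 2) ^+ N.+1) (q ^+ N.+1) d2 d0 d4 dd0 => d' d d2 d0 d4 dd0.
move=> P1 P2 P10 P20 l1 l2 g1 g2.
have x10 : 0 <= x1 by apply: le_trans g1; rewrite mulr_ge0//; lra.
have x20 : 0 <= x2 by apply: le_trans g2; rewrite mulr_ge0//; lra.
have xy : x1 * x2 <= y1 * y2 by rewrite ler_pM.
have yx : y1 * y2 - x1 * x2 <= 4 * d.
  have h1 : y1 - x1 <= 2 * d by nra.
  have h2 : y2 - x2 <= 2 * d by nra.
  have -> : y1 * y2 - x1 * x2 = (y1 - x1) * y2 + x1 * (y2 - x2) by ring.
  have : (y1 - x1) * y2 <= 2 * d by nra.
  have : x1 * (y2 - x2) <= 2 * d by nra.
  by lra.
have y1' : y1 * y2 <= 1 by nra.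
have x0' : 0 <= x1 * x2 by exact: mulr_ge0.
have := exprB_le 8 x0' xy y1'.
have : (x1 * x2) ^+ 8 <= (y1 * y2) ^+ 8.
  by apply: lerXn2r => //; rewrite nnegrE// mulr_ge0.
move: (_ ^+ 8) (_ ^+ 8) => u v uv h.
rewrite ler0_norm; last by lra.
by nra.
Qed.

(** Both truncations approximate the same function up to [O(q^(N+1))], so their difference [p] has
    no coefficient of index at most [N]. *)
Lemma eta8_eta8_coefE (R : realType) (tau : nat -> int) (N m : nat) :
  eta8_eta8_coefficients R tau -> (0 < m)%N -> (m <= N)%N ->
  tau m = ('X * (euler_poly N ^+ 8 * (euler_poly N ^+ 8 \Po 'X^2)))`_m.
Proof.
move=> htau m0 mN; set Q := 'X * _.
pose p : {poly R} := \sum_(1 <= i < N.+1) (tau i)%:~R *: 'X^i - map_poly intr Q.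
have [K hK] := power_series_tail N (eta8_eta8_real htau).
have Qq (q : R) : (map_poly intr Q).[q] =
    q * (euler_prod q N * euler_prod (q ^+ 2) N) ^+ 8.
  rewrite /Q 2!rmorphM /= map_polyX map_comp_poly map_polyXn rmorphXn /=.
  rewrite 2!hornerM hornerX horner_comp !horner_exp hornerX !euler_prod_horner.
  by rewrite -exprMn.
have pS (q : R) : p.[q] = \sum_(1 <= i < N.+1) (tau i)%:~R * q ^+ i -
    q * (euler_prod q N * euler_prod (q ^+ 2) N) ^+ 8.
  rewrite /p hornerD hornerN Qq horner_sum; congr (_ - _).
  by apply: eq_bigr => i _; rewrite !hornerE.
have small q : 0 < q -> q <= 1 / 4 -> `|p.[q]| <= (K + 32) * q ^+ N.+1.
  move=> q0 q4; rewrite pS mulrDl.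
  have := hK _ q0 q4; have := euler_prod_lim_approx N q0 q4.
  set L := q * (limn (euler_prod q) * _) ^+ 8; set S := \sum_(1 <= i < _) _.
  set E := q * _ ^+ 8 => h1 h2; have -> : S - E = - (L - S) + (L - E) by ring.
  by apply: le_trans (ler_normD _ _) _; rewrite normrN lerD.
have : p`_m = 0 by apply: (poly_small_coef0 _ small) => //; lra.
rewrite /p coefB coef_map /= coef_sum => /eqP; rewrite subr_eq0 => /eqP pm.
apply: (@intr_inj R); rewrite -[RHS]pm.
rewrite (bigD1_seq m) /=; [|by rewrite mem_index_iota m0|exact: iota_uniq].
rewrite coefZ coefXn eqxx mulr1 big1 ?addr0// => i im.
by rewrite coefZ coefXn eq_sym (negbTE im) mulr0.
Qed.

Theorem theorem8p1 (R : realType) (tau2 : nat -> int)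
  (htau2 : eta8_eta8_coefficients R tau2) (m : nat) (hm : (0 < m)%N) :
  harmonic_strength (D4design R m) 6%N <-> tau2 m = 0.
Proof.
(* Truncating the Euler products at [m] already gives the right coefficient of index [m]. *)
rewrite (eta8_eta8_coefE htau2 hm (leqnn m)).
have c0 : (Num.sqrt (2 * m)%N%:R)^-1 != 0 :> R.
  by rewrite invr_eq0 sqrtr_eq0 -ltNge ltr0n muln_gt0.
have hsum := harmonic_sextics_vanish (2 * m) c0.
have hm1 : \sum_(v \in d4shell (2 * m)) b4sextic v =
    - 192 * ('X * (euler_poly m ^+ 8 * (euler_poly m ^+ 8 \Po 'X^2)))`_m.
  by case: m hm {c0 hsum} => // k _; exact: b4sextic_sum.
rewrite {}hm1 in hsum.
transitivity (- 192 * ('X * (euler_poly m ^+ 8 * (euler_poly m ^+ 8 \Po 'X^2)))`_m = 0).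
  rewrite -hsum; split=> h P /h; by rewrite D4design_fsum.
by split=> [/eqP|->]; rewrite ?mulr0// mulf_eq0 /= => /eqP.
Qed.
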